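(* Let $\mu$ be a probability measure on $(\mathcal C,\mathcal F^{\mathcal C})$ and let $h$ be a random variable with distribution $\mu$. If for all $t\ge0$ $$\mathbb E\Big[\sup_{s\in[0,t]}\|h(s)\|^2\Big]<\infty,$$ then $\mu$ is tempered.
   Context: $\mathcal C$ is the space of continuous $h:\mathbb R_+\to\mathbb R^2$ with $h(0)=0$, with the product $\sigma$-algebra $\mathcal F^{\mathcal C}$. A configuration is a finite or countable $\overline S\subset\mathbb R^2\times\mathcal C$ on which the projection onto $\mathbb R^2$ is one-to-one; $S$ denotes its projection, and $\overline S=\{(x,h_x):x\in S\}$. For $x\in S$, $t\ge 0$: $g_x(t)=x+h_x(t)$. $\overline{\mathcal S}$ is the set of configurations, with the $\sigma$-field generated by the maps $\overline S\mapsto\#(\overline S\cap A)$, $A\in\mathcal B(\mathbb R^2)\otimes\mathcal F^{\mathcal C}$. Write $\overline S-u=\{(x-u,h):(x,h)\in\overline S\}$. Lifetime functions. For $\tau:S\to(0,+\infty]$, $x\ne y\in S$, $t_x\ge0$, say that $x$ $\tau$-hits $y$ at time $t_x$ if there is $t_y\ge0$ with $t_x\le\tau(x)$, $t_y\le\tau(y)$, $g_x(t_x)=g_y(t_y)$ and $t_y\le t_x$. The function $\tau$ is an $\overline S$-lifetime function if: (Stopping) whenever $x$ $\tau$-hits $y$ at time $t_x$ (with $x\neq y$), $\tau(x)=t_x$; (Hitting) for all $x$ with $\tau(x)<\infty$ there is $y\in S\setminus\{x\}$ such that $x$ $\tau$-hits $y$ at time $\tau(x)$. A configuration is tempered if it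 has exactly one lifetime function, then denoted $\tau(\cdot;\overline S)$. Tempered measures. $\widehat{\mathcal S}$ is the set of finite or countable subsets of $\mathbb R^2\times[0,+\infty]$ on which the projection to $\mathbb R^2$ is one-to-one, with the $\sigma$-field generated by the counting maps of sets in $\mathcal B(\mathbb R^2)\otimes\mathcal B([0,+\infty])$. A set $\overline{\mathcal A}\subset\overline{\mathcal S}$ is a tempered set of configurations if it is measurable, consists of tempered configurations, is invariant under all spatial translations $\overline S\mapsto\overline S-u$ ($u\in\mathbb R^2$), and the map $\overline{\mathcal A}\to\widehat{\mathcal S}$, $\overline S\mapsto\{(x,\tau(x;\overline S)):x\in S\}$, is measurable. A probability measure $\mu$ on $(\mathcal C,\mathcal F^{\mathcal C})$ is tempered if there is a tempered set of configurations $\overline{\mathcal A}$ such that the Poisson point process $\overline\xi$ on $\mathbb R^2\times\mathcal C$ with intensity $\mathrm dx\otimes\mu$ ($\mathrm dx$ the Lebesgue measure) belongs to $\overline{\mathcal A}$ with probability one. *)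

(* Defs.v *)
From HB Require Import structures.
From mathcomp Require Import all_boot all_order all_algebra.
From mathcomp Require Import all_classical all_reals all_analysis.
From mathcomp Require Import measurable_realfun.

Set Implicit Arguments.
Unset Strict Implicit.
Unset Printing Implicit Defensive.

Import Order.TTheory GRing.Theory Num.Theory.
Import numFieldNormedType.Exports.

Local Open Scope classical_set_scope.
Local Open Scope ring_scope.

(* The plane is [R * R] with its product topology and its product (that is,
   Borel) sigma-algebra. *)

(* The norm the library puts on [R * R] is the max norm, hence this one. *)
Definition sqnorm {R : realType} (x : R * R) : R := x.1 ^+ 2 + x.2 ^+ 2.

Section path_space.
Context (R : realType).

(* A path R_+ -> R^2 is stored as a function on R whose values at negative
   times are normalised to 0, so that two paths agreeing on R_+ are equal. *)
Record path_space := Path {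
  path_fun :> R -> R * R ;
  path_continuous : {within [set t : R | 0 <= t], continuous path_fun} ;
  path_at0 : path_fun 0 = 0 ;
  path_neg : forall t, t < 0 -> path_fun t = 0 }.

Lemma cst0_continuous : {within [set t : R | 0 <= t],
  continuous (fun _ : R => 0 : R * R)}.
Proof. by apply: continuous_subspaceT => x; exact: cst_continuous. Qed.

HB.instance Definition _ := gen_eqMixin path_space.
HB.instance Definition _ := gen_choiceMixin path_space.
HB.instance Definition _ := isPointed.Build path_space
  (Path cst0_continuous erefl (fun _ _ => erefl)).

Definition path_measurable : set (set path_space) :=
  <<s \bigcup_(t in [set t : R | 0 <= t])
        preimage_set_system setT (fun h : path_space => h t) measurable >>.

Let path_measurable0 : path_measurable set0.
Proof. exact: sigma_algebra0. Qed.

Let path_measurableC A : path_measurable A -> path_measurable (~` A).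
Proof. exact: sigma_algebraC. Qed.

Let path_measurableU (F : (set path_space)^nat) :
  (forall i, path_measurable (F i)) -> path_measurable (\bigcup_i F i).
Proof. exact: sigma_algebra_bigcup. Qed.

Definition path_display : measure_display.
Proof. by constructor. Qed.

HB.instance Definition _ := @isMeasurable.Build path_display path_space
  path_measurable path_measurable0 path_measurableC path_measurableU.

End path_space.

(* Finite or countable subsets of R^2 x D, D a set of marks in M, on which the
   projection onto R^2 is one-to-one. *)
Section marked_configurations.
Context {R : realType} {d : measure_display} {M : measurableType d} (D : set M).

Record mconf := MConf {
  mconf_set : set ((R * R) * M) ;
  mconf_countable : countable mconf_set ;
  mconf_inj : forall p q, mconf_set p -> mconf_set q -> p.1 = q.1 -> p = q ;
  mconf_marks : forall p, mconf_set p -> D p.2 }.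

HB.instance Definition _ := gen_eqMixin mconf.
HB.instance Definition _ := gen_choiceMixin mconf.

Let empty_inj (p q : (R * R) * M) : set0 p -> set0 q -> p.1 = q.1 -> p = q.
Proof. by []. Qed.

Let empty_marks (p : (R * R) * M) : set0 p -> D p.2.
Proof. by []. Qed.

HB.instance Definition _ := isPointed.Build mconf
  (MConf (countable0 _) empty_inj empty_marks).

Definition mcount (A : set ((R * R) * M)) (S : mconf) : \bar R :=
  counting (mconf_set S `&` A).

(* When D is measurable, counting points in the measurable sets A of R^2 x M
   amounts to counting them in the measurable subsets of R^2 x D. *)
Definition mconf_measurable : set (set mconf) :=
  <<s \bigcup_(A in measurable)
        preimage_set_system setT (mcount A) measurable >>.

Let mconf_measurable0 : mconf_measurable set0.
Proof. exact: sigma_algebra0. Qed.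

Let mconf_measurableC A : mconf_measurable A -> mconf_measurable (~` A).
Proof. exact: sigma_algebraC. Qed.

Let mconf_measurableU (F : (set mconf)^nat) :
  (forall i, mconf_measurable (F i)) -> mconf_measurable (\bigcup_i F i).
Proof. exact: sigma_algebra_bigcup. Qed.

Definition mconf_display : measure_display.
Proof. by constructor. Qed.

HB.instance Definition _ := @isMeasurable.Build mconf_display mconf
  mconf_measurable mconf_measurable0 mconf_measurableC mconf_measurableU.

End marked_configurations.
Arguments mconf R {d M} D.
Arguments MConf {R d M D}.
Arguments mcount {R d M D} A S.

Definition conf (R : realType) := mconf R [set: path_space R].
HB.instance Definition _ (R : realType) := Measurable.on (conf R).

Definition hat_conf (R : realType) := mconf R [set v : \bar R | (0 <= v)%E].
HB.instance Definition _ (R : realType) := Measurable.on (hat_conf R).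

Section lifetime.
Context {R : realType}.
Implicit Types (S : conf R) (tau : R * R -> \bar R) (x y u : R * R) (t : R).

Definition support S : set (R * R) := fst @` mconf_set S.

(* The h_x of (x, h_x) in the configuration when x is in its support; the
   default path is never used. *)
Definition path_at S x : path_space R := xget point [set h | mconf_set S (x, h)].

Definition position S x t : R * R := x + path_at S x t.

Definition hits S tau x y (tx : R) : Prop :=
  exists ty : R, [/\ 0 <= ty, (tx%:E <= tau x)%E, (ty%:E <= tau y)%E,
    position S x tx = position S y ty & ty <= tx].

Definition stopping S tau : Prop := forall x y tx,
  support S x -> support S y -> x <> y -> 0 <= tx ->
  hits S tau x y tx -> tau x = tx%:E.

Definition hitting S tau : Prop := forall x,
  support S x -> (tau x < +oo)%E ->
  exists y, [/\ support S y, y <> x & hits S tau x y (fine (tau x))].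

(* A function S -> (0, +oo] is a total function on R^2 of which only the
   restriction to S is relevant. *)
Definition lifetime_function S tau : Prop :=
  [/\ forall x, support S x -> (0 < tau x)%E, stopping S tau & hitting S tau].

Definition tempered_conf S : Prop :=
  exists tau, lifetime_function S tau /\
    forall tau', lifetime_function S tau' -> {in support S, tau' =1 tau}.

(* +oo is a dummy value for configurations that are not tempered. *)
Definition lifetime S : R * R -> \bar R :=
  if pselect (tempered_conf S) is left H then projT1 (cid H) else cst +oo%E.

Lemma lifetimeP S : tempered_conf S -> lifetime_function S (lifetime S).
Proof.
by rewrite /lifetime; case: pselect => // H _; case: (cid H) => ? /= [].
Qed.

Lemma lifetime_ge0 S x : support S x -> (0 <= lifetime S x)%E.
Proof.
move=> Sx; have [/lifetimeP[+ _ _]|nS] := pselect (tempered_conf S).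
  by move=> /(_ _ Sx)/ltW.
by rewrite /lifetime; case: pselect => //= _; rewrite leey.
Qed.

Section lifetime_graph.
Context (S : conf R).

Let graph : set ((R * R) * \bar R) := (fun x => (x, lifetime S x)) @` support S.

Let graph_countable : countable graph.
Proof.
do 2 apply: (card_le_trans (card_image_le _ _)); exact: mconf_countable.
Qed.

Let graph_inj p q : graph p -> graph q -> p.1 = q.1 -> p = q.
Proof. by move=> [x _ <-] [y _ <-] /= ->. Qed.

Let graph_marks p : graph p -> (0 <= p.2)%E.
Proof. by move=> [x Sx <-]; exact: lifetime_ge0. Qed.

Definition lifetime_graph : hat_conf R :=
  MConf graph graph_countable graph_inj graph_marks.

End lifetime_graph.

Section translate.
Context (u : R * R) (S : conf R).

Let shifted : set ((R * R) * path_space R) :=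
  (fun p => (p.1 - u, p.2)) @` mconf_set S.

Let shifted_countable : countable shifted.
Proof. exact: (card_le_trans (card_image_le _ _) (mconf_countable S)). Qed.

Let shifted_inj p q : shifted p -> shifted q -> p.1 = q.1 -> p = q.
Proof.
by move=> [a Sa <-] [b Sb <-] /= /addIr ab; rewrite (mconf_inj Sa Sb ab).
Qed.

Definition translate : conf R :=
  MConf shifted shifted_countable shifted_inj (fun _ _ => I).

End translate.

Definition tempered_set (A : set (conf R)) : Prop :=
  [/\ measurable A,
      A `<=` tempered_conf,
      forall u S, A S -> A (translate u S) &
      measurable_fun A lifetime_graph].

End lifetime.

Section poisson_process.
Context {R : realType} {d dO : measure_display} {M : measurableType d}.
Context {D : set M} {Omega : measurableType dO}.

(* [Lambda] is a bare set function because [lebesgue_measure] is a measure on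
   [measurableTypeR R], which has the same measurable sets as [R] but another
   display.  In [poisson_prob r k U], the argument [k] has no effect. *)
Definition poisson_point_process (P : probability Omega R)
    (xi : {mfun Omega >-> mconf R D})
    (Lambda : set ((R * R) * M) -> \bar R) : Prop :=
  (forall A, measurable A ->
     ((Lambda A < +oo)%E -> forall k : nat,
        P [set w | mcount A (xi w) = k%:R%:E]
        = poisson_prob (fine (Lambda A)) 0 [set k]) /\
     (Lambda A = +oo%E -> P [set w | mcount A (xi w) = +oo%E] = 1%E)) /\
  (forall (n : nat) (A : 'I_n -> set ((R * R) * M)) (B : 'I_n -> set (\bar R)),
     (forall i, measurable (A i)) -> trivIset setT A ->
     (forall i, measurable (B i)) ->
     P [set w | forall i, B i (mcount (A i) (xi w))]
     = (\prod_(i < n) P [set w | B i (mcount (A i) (xi w))])%E).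

End poisson_process.

Definition intensity {R : realType} (mu : probability (path_space R) R) :
  set ((R * R) * path_space R) -> \bar R :=
  ((lebesgue_measure \x lebesgue_measure) \x mu)%E.

(* The law of a Poisson process being determined by its intensity, every
   realisation of it, on any probability space, is required to lie in A. *)
Definition tempered {R : realType} (mu : probability (path_space R) R) : Prop :=
  exists A : set (conf R), tempered_set A /\
    forall (dO : measure_display) (Omega : measurableType dO)
      (P : probability Omega R) (xi : {mfun Omega >-> conf R}),
      poisson_point_process P xi (intensity mu) -> P (xi @^-1` A) = 1%E.

(* Main.v *)
(* Let Phi map a function tau on S to the first time a path meets the portion
   up to tau of another path already gone through the meeting point.  Phi is
   antitone and the lifetime functions are its fixed points, so that they lie
   between the limits of the odd and of the even iterates of Phi from +oo; a
   locally finite configuration on which these limits agree is tempered, and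
   such configurations form a tempered set.
   If time is cut into windows in each of which every point belongs to a finite
   set closed under meetings during the window, then the iterates, once they are
   eventually constant up to the beginning of a window, are so up to its end,
   and the limits agree.  By uniform continuity of the paths and the moment
   hypothesis, in short windows the oscillation of the paths has an arbitrarily
   small second moment, so that these sets are clusters of a subcritical Boolean
   model: as in Gouere's proof that a small second moment of the radius excludes
   percolation, crossing a large box at scale 20 al requires either an
   exceptionally large grain or two crossings at scale al in disjoint boxes,
   which are independent. *)
Require Import Defs.
From HB Require Import structures.
From mathcomp Require Import all_boot all_order all_algebra.
From mathcomp Require Import all_classical all_reals all_analysis.
From mathcomp Require Import measurable_realfun.
From mathcomp Require Import ring lra zify.

Set Implicit Arguments.
Unset Strict Implicit.
Unset Printing Implicit Defensive.

Import Order.TTheory GRing.Theory Num.Theory.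
Import numFieldNormedType.Exports.

Local Open Scope classical_set_scope.
Local Open Scope ring_scope.

(** Two sizes are chosen independently. The length of the windows makes the second moment of the
    oscillation small; the mesh only starts the recursion on scales, a box of a few cells being
    empty with high probability. From one scale to the next a grain comparable to the box must be
    excluded: the area in which it can sit is proportional to the square of its size, so that its
    intensity is at most a constant times the second moment, whatever the scale and the mesh. This
    scale invariance, proper to the exponent 2 in the plane, is why one bound on the moment serves
    at every scale. Paths are discretised into sites because a crossing then depends on finitely
    many bits, each telling whether one of pairwise disjoint sets of marked points is hit;
    independence of distant crossings thus reduces to that of counts. Rounding can only enlarge the
    clusters, being compensated in the linking distance. Confinement only asks for good scales
    beyond every bound, so that convergence of the probabilities to 0, without a rate, is enough. *)

Definition inv_succ {R : realType} (k : nat) : R := k.+1%:R^-1.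

(** * Compactness and uniform continuity of paths *)

Section paths.
Context {R : realType}.
Implicit Types (h : path_space R) (x y : R * R) (s t a e : R).

Lemma prod_norm_le x e : (`|x| <= e) = (`|x.1| <= e) && (`|x.2| <= e).
Proof. by rewrite prod_normE ge_max. Qed.

Lemma prod_norm_lt x e : (`|x| < e) = (`|x.1| < e) && (`|x.2| < e).
Proof. by rewrite prod_normE gt_max. Qed.

Lemma inv_succ_gt0 k : 0 < inv_succ k :> R.
Proof. by rewrite invr_gt0. Qed.

Lemma inv_succ_le1 k : inv_succ k <= 1 :> R.
Proof. by rewrite invf_le1// ler1n. Qed.

Lemma inv_small e : 0 < e -> exists N, forall k, (N <= k)%N -> inv_succ k < e.
Proof.
move=> e0; exists (Num.truncn e^-1) => k Nk.
rewrite /inv_succ -[ltRHS]invrK ltf_pV2 ?posrE ?invr_gt0//.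
by apply: lt_le_trans (truncnS_gt _) _; rewrite ler_nat.
Qed.

Lemma path_continuousP h t e : 0 <= t -> 0 < e ->
  exists2 dl : R, 0 < dl & forall s, 0 <= s -> `|s - t| < dl -> `|h s - h t| < e.
Proof.
move=> t0 e0; have /subspace_continuousP/(_ t t0) := @path_continuous _ h.
move=> /cvgrPdist_lt /(_ e e0); rewrite near_withinE => /nbhs_ballP[dl /= dl0 H].
exists dl => // s s0 st; rewrite distrC; apply: H => //.
by rewrite /ball /= distrC.
Qed.

(** Compactness of the square: both sequences are approximated along the same indices, as a pair of
    nearly meeting times requires. *)
Lemma bolzano_weierstrass2 a (u v : nat -> R) :
  (forall k, 0 <= u k <= a) -> (forall k, 0 <= v k <= a) ->
  exists s t, [/\ 0 <= s <= a, 0 <= t <= a &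
    forall e N, 0 < e -> exists k, [/\ (N <= k)%N, `|u k - s| < e & `|v k - t| < e]].
Proof.
move=> ua va.
have cpt := compact_setX (@segment_compact R 0 a) (@segment_compact R 0 a).
have [|[s t] [[/= sa ta] clu]] := cpt ((fun k => (u k, v k)) @ \oo) _.
  by exists 0%N => // k _; split; rewrite /= in_itv /=.
exists s, t; split; [by move: sa; rewrite in_itv|by move: ta; rewrite in_itv|].
move=> e N e0.
have [_ [[k /= Nk <-] [/= h1 h2]]] :
    ((fun k => (u k, v k)) @` [set k | (N <= k)%N]) `&` (ball s e `*` ball t e) !=set0.
  apply: clu; last by exists (ball s e, ball t e) => //; split; exact: nbhsx_ballx.
  by exists N => // k /= Nk; exists k.
by exists k; split => //; rewrite distrC.
Qed.

Lemma path_bounded h a : exists2 B : R, 0 < B & forall t, 0 <= t <= a -> `|h t| < B.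
Proof.
apply: contrapT => nB.
have /choice[u uP] : forall k : nat, exists s : R, 0 <= s <= a /\ k%:R < `|h s|.
  move=> k.
  apply: contrapT => nk; apply: nB; exists k.+1%:R => // t ta.
  rewrite ltNge; apply/negP => kt; apply: nk; exists t; split => //.
  by apply: lt_le_trans kt; rewrite ltr_nat.
have [s [s' [/andP[s0 _] _ H]]] :=
  bolzano_weierstrass2 (fun k => (uP k).1) (fun k => (uP k).1).
have [dl dl0 sP] := path_continuousP h s0 (@ltr01 R).
have [k [nk ks _]] := H dl (Num.truncn (1 + `|h s|)).+1 dl0.
have [/andP[uk0 _] uk2] := uP k.
have := sP _ uk0 ks; apply/negP; rewrite -leNgt.
have : (Num.truncn (1 + `|h s|)).+1%:R <= k%:R :> R by rewrite ler_nat.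
have := truncnS_gt (1 + `|h s|).
have := lerB_dist (h (u k)) (h s); lra.
Qed.

Lemma path_unif_continuous h a e : 0 < e ->
  exists2 dl : R, 0 < dl & forall s t, 0 <= s <= a -> 0 <= t <= a ->
    `|s - t| < dl -> `|h s - h t| < e.
Proof.
move=> e0; apply: contrapT => nB.
have /choice[u uP] : forall k : nat, exists s : R * R,
    [/\ 0 <= s.1 <= a, 0 <= s.2 <= a, `|s.1 - s.2| < inv_succ k & e <= `|h s.1 - h s.2|].
  move=> k.
  apply: contrapT => nk; apply: nB; exists (inv_succ k); first exact: inv_succ_gt0.
  move=> s t sa ta st.
  by rewrite ltNge; apply/negP => kt; apply: nk; exists (s, t); split.
have u1 k : 0 <= (u k).1 <= a by have [] := uP k.
have u2 k : 0 <= (u k).2 <= a by have [] := uP k.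
have [s [s' [/andP[s0 _] _ H]]] := bolzano_weierstrass2 u1 u2.
have [dl dl0 sP] := path_continuousP h s0 (divr_gt0 e0 (ltr0Sn _ 1)).
have dl20 : 0 < dl / 2 by lra.
have [N NP] := inv_small dl20.
have [k [/NP kdl ks _]] := H (dl / 2) N dl20.
have [/andP[u0 _] /andP[v0 _] uv uvh] := uP k.
have h1 : `|h (u k).1 - h s| < e / 2 by apply: sP => //; lra.
have h2 : `|h (u k).2 - h s| < e / 2.
  apply: sP => //; apply: le_lt_trans (ler_distD (u k).1 _ _) _.
  by rewrite [ltRHS]splitr ltrD// distrC (lt_trans uv).
have := ler_distD (h s) (h (u k).1) (h (u k).2); rewrite (distrC (h s) (h (u k).2)); lra.
Qed.

Lemma rat_between s t : s < t -> exists q : rat, s < ratr q < t.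
Proof. by move=> /rat_in_itvoo[q]; rewrite in_itv /=; exists q. Qed.

End paths.

Notation mpoint R := ((R * R) * path_space R)%type.

(** Attached to the marked point itself, hence free of the choice of a path in [path_at]; the two
    agree on configurations by [positionE]. *)
Definition gpos {R : realType} (p : mpoint R) (t : R) : R * R := p.1 + p.2 t.

(** * The map [Phi], its iterates and its fixed points *)

Section meeting.
Context {R : realType}.
Implicit Types (p q : mpoint R) (S : conf R) (s t a e : R) (c : \bar R)
  (tau : mpoint R -> \bar R).

Lemma gpos_continuousP p t e : 0 <= t -> 0 < e ->
  exists2 dl : R, 0 < dl & forall s, 0 <= s -> `|s - t| < dl -> `|gpos p s - gpos p t| < e.
Proof.
move=> t0 e0; have [dl dl0 H] := path_continuousP p.2 t0 e0.
by exists dl => // s s0 st; rewrite /gpos opprD addrACA subrr add0r; exact: H.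
Qed.

(* By compactness, meeting amounts to almost meeting at rational times with every
   precision, which makes it a measurable condition. *)
Definition near_meet p q c a (k : nat) := exists u v : rat,
  let e := inv_succ k in
  [/\ 0 <= ratr u :> R, 0 <= ratr v :> R, ratr u <= ratr v + e & ratr v <= a + e] /\
  ((ratr u - e)%:E < c)%E /\ `|gpos p (ratr v) - gpos q (ratr u)| < e.

Lemma near_meet_limit p q c a : 0 <= a -> (forall k, near_meet p q c a k) ->
  exists s t, [/\ 0 <= s <= t, t <= a, (s%:E <= c)%E & gpos p t = gpos q s].
Proof.
move=> a0 /choice[u] /choice[v] /all_and2[/all_and4[u0 v0 uv va] /all_and2[uc uvp]].
have k1 := @inv_succ_le1 R.
(* All errors are at most 1, whence the bound [a + 2]. *)
have ua k : (0 : R) <= ratr (u k) <= a + 2.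
  by rewrite u0 /=; have := uv k; have := va k; have := k1 k; lra.
have va' k : (0 : R) <= ratr (v k) <= a + 2.
  by rewrite v0 /=; have := va k; have := k1 k; lra.
have [s [t [/andP[s0 _] /andP[t0 _] H]]] := bolzano_weierstrass2 ua va'.
have {}H e : 0 < e -> exists k, [/\ inv_succ k < e, `|ratr (u k) - s| < e &
   `|ratr (v k) - t| < e].
  move=> e0; have [N NP] := inv_small e0.
  by have [k [/NP ? ? ?]] := H e N e0; exists k.
exists s, t; split.
- rewrite s0 /=; apply/ler_addgt0Pr => e e0.
  have [|k [h1 h2 h3]] := H (e / 3); first by lra.
  by have := uv k; move: h2 h3; rewrite !ltr_norml => /andP[? ?] /andP[? ?]; lra.
- apply/ler_addgt0Pr => e e0.
  have [|k [h1 h2 h3]] := H (e / 3); first by lra.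
  by have := va k; move: h2 h3; rewrite !ltr_norml => /andP[? ?] /andP[? ?]; lra.
- case: c uc => [c uc| |/(_ 0%N)//]; last by rewrite leey.
  rewrite lee_fin; apply/ler_addgt0Pr => e e0.
  have [|k [h1 h2 h3]] := H (e / 3); first by lra.
  have := uc k; rewrite lte_fin.
  by move: h2 h3; rewrite !ltr_norml => /andP[? ?] /andP[? ?]; lra.
- apply/eqP; rewrite -subr_eq0 -normr_le0; apply/ler_addgt0Pr => e e0; rewrite add0r.
  have e3 : 0 < e / 3 by lra.
  have [d1 d10 h1] := gpos_continuousP p t0 e3.
  have [d2 d20 h2] := gpos_continuousP q s0 e3.
  have [|k [k1' k2 k3]] := H (Num.min (e / 3) (Num.min d1 d2)).
    by rewrite !lt_min e3 d10.
  move: k1' k2 k3; rewrite !lt_min => /and3P[? _ _] /and3P[_ _ k2] /and3P[_ k3 _].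
  have {h1} := h1 _ (v0 k) k3; have {h2} := h2 _ (u0 k) k2; have {uvp} := uvp k.
  set x := gpos p t; set y := gpos q s; set x' := gpos p _; set y' := gpos q _.
  move=> xy' yy xx; rewrite ltW//.
  rewrite (_ : e = e / 3 + e / 3 + e / 3); last by lra.
  apply: le_lt_trans (ler_distD y' _ _) _; apply: ltrD => //.
  apply: le_lt_trans (ler_distD x' _ _) _; apply: ltrD => //; first by rewrite distrC.
  exact: lt_trans xy' _.
Qed.

(** The rational times are taken just above [s] and [t], which keeps them nonnegative; the strict
    inequality [t < a + inv_succ k] leaves room above [t]. *)
Lemma meet_near p q c a k s t : 0 <= s <= t -> t < a + inv_succ k -> (s%:E <= c)%E ->
  gpos p t = gpos q s -> near_meet p q c a k.
Proof.
move=> /andP[s0 st] ta sc pq; pose e : R := inv_succ k; rewrite -/e in ta *.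
have e0 : 0 < e by exact: inv_succ_gt0.
have e2 : 0 < e / 2 by lra.
have t0 : 0 <= t by exact: le_trans st.
have [d1 d10 h1] := gpos_continuousP p t0 e2.
have [d2 d20 h2] := gpos_continuousP q s0 e2.
have [u /andP[su ud]] : exists u : rat, s < ratr u < s + Num.min e d2.
  by apply: rat_between; rewrite ltrDl lt_min e0.
have [v /andP[tv vd]] : exists v : rat, t < ratr v < t + Num.min (a + e - t) d1.
  by apply: rat_between; rewrite ltrDl lt_min d10 subr_gt0 andbT.
move: ud vd; rewrite -!ltrBlDl !lt_min => /andP[u1 u2] /andP[v1 v2].
exists u, v => /=; rewrite -/e; split; [split|split].
- by rewrite ltW// (le_lt_trans s0).
- by rewrite ltW// (le_lt_trans t0).
- by lra.
- by lra.
- by apply: lt_le_trans sc; rewrite lte_fin; lra.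
- rewrite (_ : e = e / 2 + e / 2); last by lra.
  apply: le_lt_trans (ler_distD (gpos p t) _ _) _; apply: ltrD.
    by apply: h1; [rewrite ltW// (le_lt_trans t0)|rewrite gtr0_norm ?subr_gt0].
  rewrite pq distrC; apply: h2; first by rewrite ltW// (le_lt_trans s0).
  by rewrite gtr0_norm ?subr_gt0.
Qed.

Lemma near_meetW p q c a k k' : (k <= k')%N -> near_meet p q c a k' -> near_meet p q c a k.
Proof.
move=> kk [u [v /= [[u0 v0 uv va] [uc pq]]]]; exists u, v => /=.
have ee : inv_succ k' <= inv_succ k :> R by rewrite lef_pV2 ?posrE// ler_nat.
split; [split => //|split]; [lra|lra| |exact: lt_le_trans ee].
by apply: le_lt_trans uc; rewrite lee_fin; lra.
Qed.

(** Only the other path is cut, at [tau q]: the time of [p] itself is unrestricted, so that a larger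
    [tau] means more obstacles. *)
Definition meets S tau p t := 0 <= t /\ exists q s, [/\ mconf_set S q, q.1 <> p.1,
  0 <= s <= t, (s%:E <= tau q)%E & gpos p t = gpos q s].

Definition Phi S tau p : \bar R := ereal_inf [set t%:E | t in meets S tau p].

Lemma Phi_ge0 S tau p : (0 <= Phi S tau p)%E.
Proof. by apply: le_ereal_inf_tmp => _ [t [t0 _] <-]; rewrite lee_fin. Qed.

Lemma Phi_le S tau p t : meets S tau p t -> (Phi S tau p <= t%:E)%E.
Proof. by move=> m; apply: ereal_inf_lbound; exists t. Qed.

(* As the ball is open, rational times suffice. *)
Definition visits (n m : nat) : set (mpoint R) := [set q : mpoint R | exists r : rat,
  0 <= (ratr r : R) <= m%:R /\ `|gpos q (ratr r)| < n%:R ].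

Definition locally_finite S := forall n m, finite_set (mconf_set S `&` visits n m).

Lemma visitsP q s (n m : nat) : 0 <= s < m%:R -> `|gpos q s| < n%:R -> visits n m q.
Proof.
move=> /andP[s0 sm] qs; have e0 : 0 < n%:R - `|gpos q s| by rewrite subr_gt0.
have [dl dl0 H] := gpos_continuousP q s0 e0.
have [r /andP[sr]] : exists r : rat, s < ratr r < Num.min m%:R (s + dl).
  by apply: rat_between; rewrite lt_min sm ltrDl.
rewrite lt_min => /andP[rm rd].
have r0 : 0 <= ratr r :> R by rewrite ltW// (le_lt_trans s0).
exists r; rewrite r0 ltW//; split => //.
have := H _ r0; rewrite gtr0_norm ?subr_gt0// ltrBlDl => /(_ rd).
rewrite ltrBrDl; apply: le_lt_trans.
by rewrite -{1}[gpos q (ratr r)](subrKC (gpos q s)) ler_normD.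
Qed.

Lemma gpos_bounded p a : exists n : nat, forall t, 0 <= t <= a -> `|gpos p t| < n%:R.
Proof.
have [B B0 H] := path_bounded p.2 a.
exists (Num.truncn (`|p.1| + B)).+1 => t /H tB.
apply: lt_trans (truncnS_gt _); apply: le_lt_trans (ler_normD _ _) _.
by rewrite ltrD2l.
Qed.

(** Up to time [a] the path of [p] stays in a ball, which only finitely many paths visit by then.
    This finiteness turns infima over obstacles into minima. *)
Lemma locally_finite_meet S p a : locally_finite S ->
  finite_set [set q | mconf_set S q /\ exists s t,
    [/\ 0 <= s <= a, 0 <= t <= a & gpos p t = gpos q s]].
Proof.
move=> fS; have [n nP] := gpos_bounded p a.
apply: sub_finite_set (fS n (Num.truncn a).+1) => q [Sq [s [t [/andP[s0 sa] ta pq]]]].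
split => //; apply: (@visitsP q s); last by rewrite -pq nP.
by rewrite s0 /=; apply: le_lt_trans sa (truncnS_gt _).
Qed.

(** Pigeonhole: a point that fails at some [k] fails at all larger ones, so if each point of [F]
    failed somewhere, a single [k] would defeat them all. *)
Lemma finite_forall_exists (T : choiceType) (F : set T) (P : T -> nat -> Prop) :
  finite_set F -> (forall x k k', (k <= k')%N -> P x k' -> P x k) ->
  (forall k, exists2 x, F x & P x k) -> exists2 x, F x & forall k, P x k.
Proof.
move=> /finite_seqP[r ->] Pk Pex; apply: contrapT => nP.
have /choice[f fP] : forall x, exists k, x \in r -> ~ P x k.
  move=> x; have [xr|xr] := boolP (x \in r); last by exists 0%N.
  apply: contrapT => H; apply: nP; exists x => // k.
  by apply: contrapT => nPk; apply: H; exists k.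
have [x /= xr /Pk xP] := Pex (\max_(x <- r) f x)%N.
exact/(fP x xr)/xP/leq_bigmax_seq.
Qed.

(** The meetings approaching the infimum involve finitely many obstacles, so one and the same [q]
    nearly meets [p] with every precision, and compactness provides a true meeting with it. *)
Lemma Phi_attained S tau p : locally_finite S -> (Phi S tau p < +oo)%E ->
  exists2 t, Phi S tau p = t%:E & meets S tau p t.
Proof.
move=> fS; have := Phi_ge0 S tau p.
case E : (Phi S tau p) => [a| |]// a0 _; rewrite lee_fin in a0.
have [q [Sq qp] qk] : exists2 q, mconf_set S q /\ q.1 <> p.1 &
    forall k, near_meet p q (tau q) a k.
  have := @finite_forall_exists _ [set q | (mconf_set S q /\ exists s t,
    [/\ 0 <= s <= a + 1, 0 <= t <= a + 1 & gpos p t = gpos q s]) /\ q.1 <> p.1]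
    (fun q k => near_meet p q (tau q) a k) _ _ _.
  case.
  - by apply: sub_finite_set (locally_finite_meet p (a + 1) fS) => q [].
  - by move=> q k k' kk; exact: near_meetW.
  - move=> k; have : (ereal_inf [set t%:E | t in meets S tau p] < (a + inv_succ k)%:E)%E.
      by rewrite -/(Phi S tau p) E lte_fin ltrDl inv_succ_gt0.
    move=> /ereal_inf_lt[_ [t [t0 [q [s [Sq qp st sq pq]]]] <-]]; rewrite lte_fin => tk.
    have k1 := inv_succ_le1 k : inv_succ k <= 1 :> R.
    exists q; last exact: meet_near tk sq pq.
    split => //; split => //; exists s, t; split => //; move/andP: st => [? ?]; lra.
  by move=> q [[Sq _] qp] H; exists q.
have [s [t [st ta sc pq]]] := near_meet_limit a0 qk.
have mt : meets S tau p t.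
  by split; [move/andP: st => [? ?]; lra|exists q, s].
exists t => //; congr (_%:E); apply/eqP; rewrite eq_le ta andbT.
by rewrite -lee_fin -E Phi_le.
Qed.

Lemma Phi_leP S tau p a : locally_finite S -> 0 <= a -> (Phi S tau p <= a%:E)%E <->
  exists2 q, mconf_set S q /\ q.1 <> p.1 & forall k, near_meet p q (tau q) a k.
Proof.
move=> fS a0; split.
  move=> pa; have [|t E [t0 [q [s [Sq qp st sq pq]]]]] := @Phi_attained S tau p fS.
    by apply: le_lt_trans pa _; rewrite ltry.
  exists q => // k; apply: meet_near st _ sq pq.
  by move: pa; rewrite E lee_fin => /le_lt_trans; apply; rewrite ltrDl inv_succ_gt0.
move=> [q [Sq qp] qk].
have [s [t [st ta sc pq]]] := near_meet_limit a0 qk.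
apply: (@le_trans _ _ t%:E); last by rewrite lee_fin.
by apply: Phi_le; split; [move/andP: st => [? ?]; lra|exists q, s].
Qed.

Lemma Phi_antitone S tau tau' p : (forall q, mconf_set S q -> (tau q <= tau' q)%E) ->
  (Phi S tau' p <= Phi S tau p)%E.
Proof.
move=> H; apply: le_ereal_inf_tmp => _ [t [t0 [q [s [Sq qp st sq pq]]]] <-].
by apply: Phi_le; split => //; exists q, s; split => //; exact: le_trans (H _ Sq).
Qed.

(** The infimum is attained, and at time 0 every point is still at its own starting position. *)
Lemma Phi_gt0 S tau p : locally_finite S -> (0 < Phi S tau p)%E.
Proof.
move=> fS; rewrite lt_neqAle Phi_ge0 andbT; apply/eqP => E.
have [|t] := @Phi_attained S tau p fS; first by rewrite -E ltry.
rewrite -E => -[<-] [_ [q [s [Sq qp]]]].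
rewrite -eq_le => /eqP <- _.
by rewrite /gpos !path_at0 !addr0 => /esym.
Qed.

Definition iterates S n := iter n (Phi S) (cst +oo%E).

Lemma iteratesS S n : iterates S n.+1 = Phi S (iterates S n).
Proof. by []. Qed.

Lemma iterates_ge0 S n p : (0 <= iterates S n p)%E.
Proof. by case: n => [|n]; [rewrite /= leey|exact: Phi_ge0]. Qed.

(** The base case is that [+oo] is the largest function; each application of the antitone [Phi]
    reverses the inequality and the parity of [n]. *)
Lemma iterates_sandwich S n m p : (n <= m)%N ->
  if odd n then (iterates S n p <= iterates S m p)%E
  else (iterates S m p <= iterates S n p)%E.
Proof.
elim: n m p => [|n IH] [|m] p //= nm; first by rewrite leey.
by have := IH m _ nm; case: (odd n) => H /=; apply: Phi_antitone => q _; exact: H.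
Qed.

Definition upper_time S p := ereal_inf [set iterates S n.*2 p | n in setT].
Definition lower_time S p := ereal_sup [set iterates S n.*2.+1 p | n in setT].

Lemma upper_time_le S n p : (upper_time S p <= iterates S n.*2 p)%E.
Proof. by apply: ereal_inf_lbound; exists n. Qed.

Lemma le_lower_time S n p : (iterates S n.*2.+1 p <= lower_time S p)%E.
Proof. by apply: ereal_sup_ubound; exists n. Qed.

Lemma lower_le_upper_time S p : (lower_time S p <= upper_time S p)%E.
Proof.
apply: ge_ereal_sup => _ [n _ <-]; apply: le_ereal_inf_tmp => _ [m _ <-].
have [/(iterates_sandwich S p)|/ltnW/(iterates_sandwich S p)] := leqP n.*2.+1 m.*2.
  by rewrite /= odd_double.
by rewrite odd_double.
Qed.

Lemma fixpoint_between S (f : mpoint R -> \bar R) :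
  (forall p, mconf_set S p -> f p = Phi S f p) ->
  forall p, mconf_set S p -> (lower_time S p <= f p <= upper_time S p)%E.
Proof.
move=> fE; have H n : forall p, mconf_set S p ->
    if odd n then (iterates S n p <= f p)%E else (f p <= iterates S n p)%E.
  elim: n => [|n IH] p Sp; first by rewrite /= leey.
  rewrite iteratesS fE//=; case: ifPn => /= on; apply: Phi_antitone => q /IH.
    by rewrite (negbTE on).
  by move: on; rewrite negbK => ->.
move=> p Sp; apply/andP; split.
  by apply: ge_ereal_sup => _ [n _ <-]; have := H n.*2.+1 p Sp; rewrite /= odd_double.
by apply: le_ereal_inf_tmp => _ [n _ <-]; have := H n.*2 p Sp; rewrite odd_double.
Qed.

(** Let [U] be the common limit. Even iterates lie above [U], so [Phi U] is above the odd ones; odd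
    iterates lie below [U], so [Phi U] is below the even ones. *)
Lemma upper_time_fixpoint S : (forall p, mconf_set S p -> lower_time S p = upper_time S p) ->
  forall p, mconf_set S p -> upper_time S p = Phi S (upper_time S) p.
Proof.
move=> LU p Sp; apply/eqP; rewrite eq_le; apply/andP; split.
  rewrite -LU//; apply: ge_ereal_sup => _ [n _ <-].
  by rewrite iteratesS; apply: Phi_antitone => q Sq; exact: upper_time_le.
apply: le_ereal_inf_tmp => _ [[|n] _ <-]; first by rewrite leey.
rewrite doubleS iteratesS; apply: Phi_antitone => q Sq.
by rewrite -LU//; exact: le_lower_time.
Qed.

Lemma path_atE S p : mconf_set S p -> path_at S p.1 = p.2.
Proof.
move=> Sp; apply: xget_unique; first by rewrite /= -surjective_pairing.
by move=> h /= Sh; have := mconf_inj Sh Sp erefl => <-.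
Qed.

Lemma positionE S p t : mconf_set S p -> position S p.1 t = gpos p t.
Proof. by move=> Sp; rewrite /position path_atE. Qed.

(** A meeting before [tau p] would be a hit, at which stopping ends [p]: hence [tau <= Phi]. The hit
    at [tau p] is a meeting: hence [Phi <= tau]. Conversely, hitting holds because the infimum is
    attained, and positivity is [Phi_gt0]. *)
Lemma lifetime_functionP S (tau : R * R -> \bar R) : locally_finite S ->
  lifetime_function S tau <->
  forall p, mconf_set S p -> tau p.1 = Phi S (tau \o fst) p.
Proof.
move=> fS; split.
  move=> [tau0 stop hit] p Sp; have Spx : Defs.support S p.1 by exists p.
  apply/eqP; rewrite eq_le; apply/andP; split.
    apply: le_ereal_inf_tmp => _ [t [t0 [q [s [Sq qp /andP[s0 st] sq pq]]]] <-].
    rewrite leNgt; apply/negP => tp.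
    suff E : tau p.1 = t%:E by rewrite E ltxx in tp.
    apply: (stop _ q.1) => //; first by exists q.
      by move=> /esym.
    by exists s; rewrite !positionE//; split => //; exact: ltW.
  have := tau0 _ Spx; case E : (tau p.1) => [t| |]// t0; last by rewrite leey.
  rewrite lte_fin in t0.
  have [|y [[q Sq <-] qp [s [s0 _ sq pq st]]]] := hit _ Spx; first by rewrite E ltry.
  rewrite E /= in pq st; apply: Phi_le; split; first exact: ltW.
  by exists q, s; rewrite s0 st; move: pq; rewrite !positionE.
move=> H; split.
- by move=> _ [p Sp <-]; rewrite H//; exact: Phi_gt0.
- move=> _ _ t [p Sp <-] [q Sq <-] pq t0 [s [s0 tp sq]]; rewrite !positionE// => e st.
  apply/eqP; rewrite eq_le tp andbT H//; apply: Phi_le; split => //.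
  by exists q, s; split => //; [exact/nesym|rewrite s0].
- move=> _ [p Sp <-]; rewrite H// => /(Phi_attained fS)[t Et].
  move=> [t0 [q [s [Sq qp /andP[s0 st] sq pq]]]].
  exists q.1; split => //; first by exists q.
  exists s; rewrite Et /= !positionE//; split => //.
  by rewrite H// Et.
Qed.

Lemma lower_eq_upper_tempered S : locally_finite S ->
  (forall p, mconf_set S p -> lower_time S p = upper_time S p) ->
  tempered_conf S /\ forall p, mconf_set S p -> lifetime S p.1 = upper_time S p.
Proof.
move=> fS LU.
have uniq (tau : R * R -> \bar R) : lifetime_function S tau ->
    forall p, mconf_set S p -> tau p.1 = upper_time S p.
  move=> /(lifetime_functionP _ fS)/fixpoint_between H p Sp.
  by have := H p Sp; rewrite LU// => /le_anti.
suff tS : tempered_conf S by split => //; exact/uniq/lifetimeP.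
(* [upper_time] needs a path besides the point; it is read at the one that [S] attaches to [x], the
   value off the support being irrelevant. *)
pose tau x := upper_time S (x, path_at S x).
have tauE p : mconf_set S p -> tau p.1 = upper_time S p.
  by move=> Sp; rewrite /tau path_atE// -surjective_pairing.
exists tau; split.
  apply/lifetime_functionP => // p Sp; rewrite tauE// upper_time_fixpoint//.
  by apply/eqP; rewrite eq_le; apply/andP; split; apply: Phi_antitone => q Sq /=;
    rewrite tauE.
move=> tau' /uniq H x; rewrite inE => -[p Sp <-].
by rewrite H// tauE.
Qed.

End meeting.

(** * Propagation of stability through a window *)

Lemma finite_min {R : realType} (T : choiceType) (F : set T) (f : T -> \bar R) :
  finite_set F -> F !=set0 -> exists2 x, F x & forall y, F y -> (f x <= f y)%E.
Proof.
move=> /finite_seqP[r ->]; elim: r => [[]//|x r IH _].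
have [[y yr]|r0] := pselect (exists y, y \in r); last first.
  exists x; first by rewrite /= mem_head.
  move=> y /=; rewrite in_cons => /orP[/eqP->//|yr].
  by exfalso; apply: r0; exists y.
have [|z zr zP] := IH; first by exists y.
have [xz|zx] := leP (f x) (f z).
  exists x; first by rewrite /= mem_head.
  by move=> w /=; rewrite in_cons => /orP[/eqP->//|/zP]; exact: le_trans.
exists z; first by rewrite /= in_cons orbC; apply/orP; left.
by move=> w /=; rewrite in_cons => /orP[/eqP->|/zP//]; exact: ltW.
Qed.

Lemma finite_common (T : choiceType) (F : set T) (P : T -> nat -> Prop) :
  finite_set F -> (forall x k k', (k <= k')%N -> P x k -> P x k') ->
  (forall x, F x -> exists k, P x k) -> exists k, forall x, F x -> P x k.
Proof.
move=> /finite_seqP[r ->] Pk Pex.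
have /choice[f fP] : forall x, exists k, x \in r -> P x k.
  move=> x; have [xr|xr] := boolP (x \in r); last by exists 0%N.
  by have [k] := Pex x xr; exists k.
exists (\max_(x <- r) f x)%N => x /= xr.
by apply: Pk (fP x xr); exact: leq_bigmax_seq.
Qed.

Section stability.
Context {R : realType}.
Implicit Types (p q x : mpoint R) (S : conf R) (s t a b : R) (C : set (mpoint R)).

(* The minimum of b and [iterates S n p] is eventually constant in n. *)
Definition stable S b p := exists n, forall m m', (n <= m)%N -> (n <= m')%N ->
  forall s, s <= b -> (s%:E <= iterates S m p)%E -> (s%:E <= iterates S m' p)%E.

(** Neither lifetimes nor the order of the two passages intervene, so that closedness concerns the
    paths alone and can be read off a percolation model. *)
Definition window_closed S a b C := forall x q, C x -> mconf_set S q ->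
  (exists s t, [/\ a <= s <= b, a <= t <= b & gpos x t = gpos q s]) -> C q.

Lemma stable0 S p : stable S 0 p.
Proof.
exists 0%N => m m' _ _ s s0 _; apply: le_trans (iterates_ge0 _ _ _).
by rewrite lee_fin.
Qed.

Lemma stable_finite S b (F : set (mpoint R)) : finite_set F ->
  (forall p, F p -> stable S b p) ->
  exists n, forall p, F p -> forall m m', (n <= m)%N -> (n <= m')%N ->
  forall s, s <= b -> (s%:E <= iterates S m p)%E -> (s%:E <= iterates S m' p)%E.
Proof.
move=> fF; apply: finite_common => // p k k' kk H m m' km km'.
by apply: H; exact: leq_trans kk _.
Qed.

Lemma le_iterates_odd S n m p : (n.*2 < m)%N -> (iterates S n.*2.+1 p <= iterates S m p)%E.
Proof. by move=> /(iterates_sandwich S p); rewrite /= odd_double. Qed.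

Lemma iterates_even_le S n m p : (n.*2 <= m)%N -> (iterates S m p <= iterates S n.*2 p)%E.
Proof. by move=> /(iterates_sandwich S p); rewrite /= odd_double. Qed.

Section step.
Variables (S : conf R) (a b : R) (C : set (mpoint R)).
Hypothesis (fS : locally_finite S).
Hypothesis (stab_a : forall p, mconf_set S p -> stable S a p).
Hypotheses (finC : finite_set C) (Ccl : window_closed S a b C).

Let X := [set x | C x /\ ~ stable S b x].

(** A point met at one of its times [s <= a] may lie outside [C]; it belongs to this finite set and
    is known to be stable up to [a]. *)
Let nbr x := [set q | mconf_set S q /\ exists s t,
    [/\ 0 <= s <= b, 0 <= t <= b & gpos x t = gpos q s]].

Let nbr_stable x : exists N,
  (forall q, nbr x q -> forall m m', (N <= m)%N -> (N <= m')%N ->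
    forall s, s <= a -> (s%:E <= iterates S m q)%E -> (s%:E <= iterates S m' q)%E) /\
  (forall q, C q -> ~ X q -> forall m m', (N <= m)%N -> (N <= m')%N ->
    forall s, s <= b -> (s%:E <= iterates S m q)%E -> (s%:E <= iterates S m' q)%E).
Proof.
have [|n0 n0P] := @stable_finite S a (nbr x) (locally_finite_meet x b fS).
  by move=> q [Sq _]; exact: stab_a.
have [| |n1 n1P] := @stable_finite S b (C `\` X).
- exact: finite_setD.
- by move=> q [Cq Xq]; apply: contrapT => nq; exact: Xq.
exists (maxn n0 n1); split => [q nq|q Cq Xq] m m'; rewrite !geq_max => /andP[? ?] /andP[? ?].
  exact: n0P.
exact: n1P.
Qed.

(** If an odd iterate at [x] exceeded [b], so would all later iterates, which lie above it, and [x]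
    would be stable up to [b]. *)
Let lower_time_unstable x : X x -> (lower_time S x <= b%:E)%E.
Proof.
move=> [_ nx]; rewrite leNgt; apply/negP => /ereal_sup_gt[_ [n _ <-] bn]; apply: nx.
exists n.*2.+1 => m m' _ nm s sb _.
apply: le_trans (le_iterates_odd S x nm); apply: le_trans (ltW bn).
by rewrite lee_fin.
Qed.

(** Otherwise take [N] beyond which the points stable in the relevant sense have settled. Stage
    [2 N + 1] stops [x] at some [t] below the limit, because of a point [q] at time [s]; a later odd
    stage exceeds [t], so [q] has by then been cut before [s]. Hence [q] has not settled, it is an
    unstable point of [C], and its [lower_time] is below [s <= t], against the minimality of [x]. *)
Let lower_time_attained x : X x -> (forall y, X y -> (lower_time S x <= lower_time S y)%E) ->
  exists n, iterates S n.*2.+1 x = lower_time S x.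
Proof.
move=> Xx xmin; apply: contrapT => nx.
have ltL n : (iterates S n.*2.+1 x < lower_time S x)%E.
  by rewrite lt_neqAle le_lower_time andbT; apply/eqP => H; apply: nx; exists n.
have [N [Na Nb]] := nbr_stable x.
have Loo : (lower_time S x < +oo)%E by apply: le_lt_trans (lower_time_unstable Xx) (ltry _).
have [|t Et] := @Phi_attained _ S (iterates S N.*2) x fS.
  by rewrite -iteratesS; exact: lt_trans (ltL N) Loo.
rewrite -iteratesS in Et => -[t0 [q [s [Sq qx /andP[s0 st] sq pq]]]].
have tL : (t%:E < lower_time S x)%E by rewrite -Et.
have tb : t <= b by rewrite -lee_fin ltW// (lt_le_trans tL)// lower_time_unstable.
have [_ [n' _ <-] tn'] := ereal_sup_gt tL.
have Nn' : (N < n')%N.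
  rewrite ltnNge; apply/negP => n'N.
  have : (n'.*2 < N.*2.+1)%N by rewrite ltnS leq_double.
  by move=> /(le_iterates_odd S x); rewrite Et leNgt tn'.
have qs : ~ (s%:E <= iterates S n'.*2 q)%E.
  move=> sq'; move: tn'; rewrite ltNge => /negP; apply; rewrite iteratesS.
  by apply: Phi_le; split => //; exists q, s; rewrite s0.
have n2 n : (n <= n.*2)%N by rewrite -addnn leq_addr.
have NN := n2 N; have Nn2 : (N <= n'.*2)%N := leq_trans (ltnW Nn') (n2 n').
have [sa|sa] := leP s a.
  apply: qs; apply: (Na q _ _ _ NN Nn2 _ sa) => //; split => //.
  by exists s, t; rewrite s0 t0 tb (le_trans st).
have Cq : C q.
  apply: (Ccl Xx.1 Sq); exists s, t.
  by rewrite tb (le_trans st tb) (ltW sa) (ltW (lt_le_trans sa st)).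
apply: (qs); apply: (Nb q Cq _ _ _ NN Nn2 _ _ sq); last exact: le_trans tb.
move=> /xmin; apply/negP; rewrite -ltNge.
apply: le_lt_trans (lower_le_upper_time _ _) _.
apply: le_lt_trans (upper_time_le _ n' _) _.
apply: lt_trans tL; apply: (@lt_le_trans _ _ s%:E); last by rewrite lee_fin.
by rewrite ltNge; exact/negP.
Qed.

(* An unstable point with least lower_time can only be stopped by points that have
   stabilised or by unstable ones, which are not stopped sooner. *)
Lemma stable_step p : C p -> stable S b p.
Proof.
move=> Cp; apply: contrapT => np.
have [||x Xx xmin] := @finite_min R _ X (lower_time S).
- by apply: sub_finite_set finC => ? [].
- by exists p.
have [n1 xn1] := lower_time_attained Xx xmin.
have [N0 [Na Nb]] := nbr_stable x.
have [|||n2 n2P] := @finite_common _ X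
   (fun y n => (lower_time S x <= iterates S n.*2.+1 y)%E).
- by apply: sub_finite_set finC => ? [].
- move=> y k k' kk /le_trans; apply; apply: le_iterates_odd.
  by rewrite ltnS leq_double.
(* In case of a tie [y] is minimal too, and its own limit is attained; otherwise some odd iterate at
   [y] already passes the limit at [x]. *)
- move=> y Xy; have := xmin y Xy; rewrite le_eqVlt => /orP[/eqP xy|].
    have [z Xz|n yn] := lower_time_attained Xy; first by rewrite -xy xmin.
    by exists n; rewrite yn xy.
  by move=> /ereal_sup_gt[_ [n _ <-] xn]; exists n; exact: ltW.
have Xx' := Xx; case: Xx' => _; apply.
pose N := maxn N0 (maxn n1 n2).
have N0N : (N0 <= N)%N by rewrite leq_maxl.
have n1N : (n1 <= N)%N by rewrite (leq_trans (leq_maxl _ n2))// leq_maxr.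
have n2N : (n2 <= N)%N by rewrite (leq_trans (leq_maxr n1 _))// leq_maxr.
have NN : (N0 <= N.*2)%N by rewrite (leq_trans N0N)// -addnn leq_addr.
have EN : iterates S N.*2.+1 x = lower_time S x.
  apply/eqP; rewrite eq_le le_lower_time -xn1; apply: le_iterates_odd.
  by rewrite ltnS leq_double.
have Lb := lower_time_unstable Xx.
have [|t Et] := @Phi_attained _ S (iterates S N.*2) x fS.
  by rewrite -iteratesS EN; apply: le_lt_trans Lb (ltry _).
rewrite -iteratesS in Et => -[t0 [q [s [Sq qx /andP[s0 st] sq pq]]]].
have tL : t%:E = lower_time S x by rewrite -Et.
have tb : t <= b by rewrite -lee_fin tL.
(* The obstacle [q] that stops [x] at stage [2 N + 1] survives to the next stage: if unstable, it is
   not cut before [lower_time S x = t], which is at least [s]. Stages [2 N + 1] and [2 N + 2] then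
   both give [t], and later ones lie between them. *)
have sq' : (s%:E <= iterates S N.*2.+1 q)%E.
  have [sa|sa] := leP s a.
    apply: (Na q _ _ _ NN (leqW NN) _ sa) => //; split => //.
    by exists s, t; rewrite s0 t0 tb (le_trans st).
  have Cq : C q.
    apply: (Ccl Xx.1 Sq); exists s, t.
    by rewrite tb (le_trans st tb) (ltW sa) (ltW (lt_le_trans sa st)).
  have [Xq|Xq] := pselect (X q); last first.
    by apply: (Nb q Cq Xq _ _ NN (leqW NN) _ _ sq); exact: le_trans tb.
  apply: (@le_trans _ _ t%:E); first by rewrite lee_fin.
  rewrite tL; apply: le_trans (n2P q Xq) _; apply: le_iterates_odd.
  by rewrite ltnS leq_double.
have E2 : (iterates S N.+1.*2 x <= t%:E)%E.
  rewrite doubleS iteratesS; apply: Phi_le; split => //.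
  by exists q, s; rewrite s0.
have Em m : (N.*2 < m)%N -> iterates S m x = t%:E.
  move=> Nm; apply/eqP; rewrite eq_le -{2}Et le_iterates_odd// andbT.
  move: Nm; rewrite leq_eqVlt => /orP[/eqP <-|]; first by rewrite Et.
  by rewrite -doubleS => /(iterates_even_le S x)/le_trans; apply.
by exists N.*2.+1 => m m' /Em -> /Em ->.
Qed.

End step.

(** A real [s] strictly between the limits would be below all even iterates and above all odd ones,
    against stability up to an integer beyond [s]. *)
Lemma stable_lower_eq_upper S p : (forall n : nat, stable S n%:R p) ->
  lower_time S p = upper_time S p.
Proof.
move=> H; apply/eqP; rewrite eq_le lower_le_upper_time leNgt; apply/negP => LU.
have [s /andP[Ls sU]] : exists s, (lower_time S p < s%:E)%E && (s%:E < upper_time S p)%E.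
  case: (lower_time S p) (upper_time S p) LU => [l| |] [u| |] //=; rewrite ?lte_fin.
  - by move=> lu; exists ((l + u) / 2); rewrite !lte_fin midf_lt//= midf_lt.
  - by move=> _; exists (l + 1); rewrite lte_fin ltrDl ltr01 ltry.
  - by move=> _; exists (u - 1); rewrite ltNyr lte_fin gtrBl ltr01.
  - by move=> _; exists 0; rewrite ltNyr ltry.
have [n nP] := H (Num.truncn s).+1.
move: Ls; rewrite ltNge => /negP; apply; apply: le_trans (le_lower_time _ n _).
apply: (nP n.*2) => //.
- by rewrite -addnn leq_addr.
- by rewrite leqW// -addnn leq_addr.
- exact/ltW/truncnS_gt.
- exact: le_trans (ltW sU) (upper_time_le _ _ _).
Qed.

End stability.

(** * Measurability through counts of marked points *)

Section measurable_sets.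
Context {d : measure_display} {T : measurableType d} {R : realType}.
Implicit Types (f g : T -> R) (F G : T -> \bar R).

Lemma measurable_set_ltr f g : measurable_fun setT f -> measurable_fun setT g ->
  measurable [set x | f x < g x].
Proof.
move=> mf mg; have := measurable_fun_ltr mf mg measurableT (I : measurable [set true]).
by rewrite setTI; congr measurable; apply/seteqP; split => x.
Qed.

Lemma measurable_set_lte F G : measurable_fun setT F -> measurable_fun setT G ->
  measurable [set x | (F x < G x)%E].
Proof. by move=> mF mG; rewrite -[X in measurable X]setTI; exact: measurable_lte. Qed.

Lemma measurable_fun_le_ereal F : (forall a : R, measurable [set x | (F x <= a%:E)%E]) ->
  measurable_fun setT F.
Proof.
move=> mF; apply: (measurability _ (ErealGenOInfty.measurableE R)).
move=> _ [_ [r ->] <-]; rewrite setTI.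
rewrite (_ : _ @^-1` _ = ~` [set x | (F x <= r%:E)%E]); first exact: measurableC.
apply/seteqP; split => x /=; rewrite in_itv /= andbT.
  by rewrite ltNge => /negP.
by move=> /negP; rewrite -ltNge.
Qed.

Lemma measurable_fun_ereal_sup (h : nat -> T -> \bar R) : (forall n, measurable_fun setT (h n)) ->
  measurable_fun setT (fun x => ereal_sup [set h n x | n in setT]).
Proof.
move=> mh; apply: measurable_fun_le_ereal => a.
rewrite (_ : mkset _ = \bigcap_n [set x | (h n x <= a%:E)%E]).
  apply: bigcapT_measurable => n.
  by have := emeasurable_fun_infty_c measurableT (mh n) a%:E; rewrite setTI.
apply/seteqP; split => x /= H.
  by move=> n _ /=; apply: le_trans H; apply: ereal_sup_ubound; exists n.
by apply: ge_ereal_sup => _ [n _ <-]; exact: H.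
Qed.

Lemma measurable_fun_ereal_inf (h : nat -> T -> \bar R) : (forall n, measurable_fun setT (h n)) ->
  measurable_fun setT (fun x => ereal_inf [set h n x | n in setT]).
Proof.
move=> mh; rewrite (_ : (fun x => _) = (fun x => - ereal_sup [set (- h n x)%E | n in setT])%E).
  apply: measurableT_comp; first exact: oppe_measurable.
  by apply: measurable_fun_ereal_sup => n; apply: measurableT_comp; first exact: oppe_measurable.
apply/funext => x; rewrite ereal_infEN; congr (- ereal_sup _)%E.
by rewrite image_comp.
Qed.

End measurable_sets.

(* Counting is a measure on the discrete sigma-algebra, so that the sets
   counted below need not be measurable. *)
Section counting_discrete.
Context {R : realType} {T : pointedType}.
Implicit Types (A B : set T) (F : (set T)^nat).

Let discrete := g_sigma_algebraType [set: set T].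

Let measurable_discrete (B : set discrete) : measurable B.
Proof. exact: sub_sigma_algebra. Qed.

Let count := @counting discrete R.

Lemma counting_sigma_additive F : trivIset setT F ->
  (\sum_(0 <= i < n) @counting T R (F i))%E @[n --> \oo] --> counting (\bigcup_i F i).
Proof.
by move=> tF; exact: (@measure_semi_sigma_additive _ discrete R count F).
Qed.

Lemma le_counting A B : A `<=` B -> (@counting T R A <= counting B)%E.
Proof.
move=> AB; apply: (@le_measure _ R discrete count) => //;
  apply: mem_set; exact: measurable_discrete.
Qed.

Lemma counting_bigcup F : {homo F : m n / (m <= n)%N >-> m `<=` n} ->
  @counting T R (\bigcup_n F n) = ereal_sup [set counting (F n) | n in setT].
Proof.
move=> ndF; have cF : (@counting T R \o F) @ \oo --> @counting T R (\bigcup_n F n).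
  apply: (@nondecreasing_cvg_mu _ discrete R count) => //.
  by move=> m n mn; apply/subsetPset/ndF.
rewrite -(cvg_lim _ cF)//; apply/cvg_lim => //.
by apply: ereal_nondecreasing_cvgn => m n mn; apply: le_counting; exact: ndF.
Qed.

End counting_discrete.

Section mark_measure.
Context {R : realType} {d : measure_display} {M : measurableType d} {D : set M}.
Implicit Types (S : mconf R D) (A B V : set ((R * R) * M)).

Lemma counting_gt0 (T : choiceType) (A : set T) : (0 < @counting T R A)%E <-> A !=set0.
Proof.
rewrite /counting; case: asboolP => fA; last first.
  split => // _; apply/set0P; apply/eqP => A0; apply: fA; rewrite A0.
  exact: finite_set0.
rewrite lte_fin ltr0n lt0n finmap.cardfs_eq0; split.
  by move=> /eqP H; apply/set0P/eqP => A0; apply: H; rewrite A0 fset_set0.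
move=> [x Ax]; apply/eqP => H.
by move: Ax; rewrite (fset_set_set0 fA H).
Qed.

Lemma counting_ltoo (T : choiceType) (A : set T) : (@counting T R A < +oo)%E <-> finite_set A.
Proof. by rewrite /counting; case: asboolP => fA; split => //; rewrite ltry. Qed.

Lemma measurable_mcount A : measurable A -> measurable_fun setT (mcount A : mconf R D -> \bar R).
Proof.
move=> mA _ B mB; rewrite setTI; apply: sub_sigma_algebra.
by exists A => //; exists B => //; rewrite setTI.
Qed.

Definition restr_count V S : set ((R * R) * M) -> \bar R :=
  fun A => mcount (V `&` A) S.

Let restr_count0 V S : restr_count V S set0 = 0%E.
Proof. by rewrite /restr_count /mcount !setI0 measure0. Qed.

Let restr_count_ge0 V S A : (0 <= restr_count V S A)%E.
Proof. exact: measure_ge0. Qed.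

Let restr_count_sigma_additive V S : semi_sigma_additive (restr_count V S).
Proof.
move=> F mF tF mUF; rewrite /restr_count /mcount 2!setI_bigcupr.
by apply: counting_sigma_additive; do 2 apply: trivIset_setIl.
Qed.

HB.instance Definition _ V S := isMeasure.Build _ _ _ (restr_count V S)
  (restr_count0 V S) (restr_count_ge0 V S) (@restr_count_sigma_additive V S).

End mark_measure.

Section capped_kernel.
Context {R : realType} {d dz : measure_display} {M : measurableType d} {D : set M}.
Context {Z : measurableType dz} (V : set ((R * R) * M)) (mV : measurable V) (m : nat).

(** Sections are measured through a finite kernel, whose mass is uniformly bounded: hence the
    restriction to [V] and the cap [m], both removed later by suprema. The factor [Z] carries a
    parameter on which the set to be counted may depend. *)
Definition capped_count (x : Z * mconf R D) : {measure set ((R * R) * M) -> \bar R} :=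
  if (mcount V x.2 <= m%:R%:E)%E then (restr_count V x.2 : {measure set _ -> \bar R}) else mzero.

Let measurable_capped_count U : measurable U ->
  measurable_fun setT (fun x => capped_count x U).
Proof.
move=> mU; rewrite (_ : (fun _ => _) = (fun x : Z * mconf R D =>
    if (mcount V x.2 <= m%:R%:E)%E then mcount (V `&` U) x.2 else 0%E)); last first.
  by apply/funext => x; rewrite /capped_count; case: ifP.
apply: measurable_fun_ifT => //.
- apply: measurable_fun_lee => //.
  have mV' := @measurable_mcount R d M D V mV.
  exact: (measurableT_comp mV' measurable_snd).
- have mVU := @measurable_mcount R d M D _ (measurableI _ _ mV mU).
  exact: (measurableT_comp mVU measurable_snd).
Qed.

HB.instance Definition _ := isKernel.Build _ _ _ _ _ capped_count measurable_capped_count.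

Let capped_count_uub : measure_fam_uub capped_count.
Proof.
exists m.+1%:R => x; rewrite /capped_count; case: ifPn => [Vm|_]; last first.
  by rewrite /mzero /= lte_fin ltr0n.
apply: (@le_lt_trans _ _ m%:R%:E); last by rewrite lte_fin ltr_nat.
by apply: le_trans Vm; apply: le_counting; apply: setIS; exact: subIsetl.
Qed.

HB.instance Definition _ := Kernel_isFinite.Build _ _ _ _ _ capped_count capped_count_uub.

Lemma measurable_capped_count_xsection (F : set ((Z * mconf R D) * ((R * R) * M))) :
  measurable F -> measurable_fun setT (fun x => capped_count x (xsection F x)).
Proof.
move=> mF; have := @measurable_fun_xsection_finite_kernel _ _ _ _ _ capped_count F.
by apply; exact: mem_set.
Qed.

End capped_kernel.

Section exists_mark.
Context {R : realType} {d dz : measure_display} {M : measurableType d} {D : set M}.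
Context {Z : measurableType dz} (V : nat -> set ((R * R) * M)).
Hypotheses (mV : forall n, measurable (V n)) (VT : \bigcup_n V n = setT).
Hypothesis ndV : {homo V : m n / (m <= n)%N >-> m `<=` n}.

Definition count_finite (S : mconf R D) := forall n, (mcount (V n) S < +oo)%E.

Lemma measurable_count_finite : measurable [set S : mconf R D | count_finite S].
Proof.
rewrite (_ : mkset _ = \bigcap_n [set S : mconf R D | (mcount (V n) S < +oo)%E]).
  apply: bigcapT_measurable => n; apply: measurable_set_lte => //.
  exact: measurable_mcount.
by apply/seteqP; split => S /= H n; [move=> _|]; exact: H.
Qed.

Lemma mcount_capped_sup (A : set ((R * R) * M)) (x : Z * mconf R D) : count_finite x.2 ->
  mcount A x.2 =
  ereal_sup [set ereal_sup [set capped_count (V n) m x A | m in setT] | n in setT].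
Proof.
move=> Vx; have -> : mcount A x.2 = ereal_sup [set mcount (V n `&` A) x.2 | n in setT].
  rewrite -[in LHS](setTI A) -VT /mcount setI_bigcupl setI_bigcupr counting_bigcup//.
  by move=> m n mn; apply: setIS; apply: setSI; exact: ndV.
congr ereal_sup; apply: eq_imagel => n _.
apply/eqP; rewrite eq_le; apply/andP; split; last first.
  apply: ge_ereal_sup => _ [m _ <-]; rewrite /capped_count; case: ifP => _ //.
  by rewrite /mzero /= measure_ge0.
have [m Vm] : exists m : nat, (mcount (V n) x.2 <= m%:R%:E)%E.
  have := Vx n; rewrite /mcount /counting; case: asboolP => // _ _.
  by eexists; exact: lexx.
by apply: ereal_sup_ubound; exists m => //; rewrite /capped_count Vm.
Qed.

Lemma measurable_mcount_section (F : set ((Z * mconf R D) * ((R * R) * M))) :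
  measurable F -> measurable_fun [set x | count_finite x.2]
    (fun x : Z * mconf R D => mcount (xsection F x) x.2).
Proof.
move=> mF; apply: (eq_measurable_fun (fun x : Z * mconf R D => ereal_sup
  [set ereal_sup [set capped_count (V n) m x (xsection F x) | m in setT] | n in setT])).
  by move=> x; rewrite inE => /mcount_capped_sup ->.
apply: measurable_funTS; apply: measurable_fun_ereal_sup => n.
by apply: measurable_fun_ereal_sup => m; exact: measurable_capped_count_xsection.
Qed.

(** Existence of a point of the configuration in a section is positivity of a count; finiteness of
    the counts on each [V n] is what allows the capped kernels to exhaust it. *)
Lemma measurable_exists_mark (F : set ((Z * mconf R D) * ((R * R) * M))) :
  measurable F -> measurable [set x : Z * mconf R D | count_finite x.2 /\
    exists2 q, mconf_set x.2 q & F (x, q)].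
Proof.
move=> mF; have mD : measurable [set x : Z * mconf R D | count_finite x.2].
  by rewrite -[X in measurable X]setTI; apply: measurable_snd => //; exact: measurable_count_finite.
have := emeasurable_fun_o_infty mD (measurable_mcount_section mF) 0%E.
congr measurable; apply/seteqP; split => x /= [Vx].
  by move=> /counting_gt0[q [Sq /xsectionP Fq]]; split => //; exists q.
move=> [q Sq Fq]; split => //; apply/counting_gt0; exists q; split => //.
exact/xsectionP.
Qed.

End exists_mark.

(** * Measurability of the iterates and of the lifetimes *)

Section path_measurability.
Context {R : realType}.
Implicit Types (S : conf R) (t a e : R).

Lemma measurable_set_cst d (T : measurableType d) (P : Prop) : measurable [set _ : T | P].
Proof.
have [HP|HP] := pselect P.
  by rewrite (_ : mkset _ = setT)//; apply/seteqP; split.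
by rewrite (_ : mkset _ = set0)//; apply/seteqP; split.
Qed.

Lemma measurable_path_eval t : 0 <= t ->
  measurable_fun setT (fun h : path_space R => h t).
Proof.
move=> t0 _ B mB; apply: sub_sigma_algebra; exists t => //.
by exists B.
Qed.

Section param.
Context {d : measure_display} {T : measurableType d}.

Lemma measurable_set_norm_lt (f : T -> R * R) e : measurable_fun setT f ->
  measurable [set x | `|f x| < e].
Proof.
move=> mf; have [mf1 mf2] := (measurable_fun_pairP f).1 mf.
rewrite (_ : mkset _ = [set x | `|(f x).1| < e] `&` [set x | `|(f x).2| < e]); last first.
  by apply/seteqP; split => x /=; rewrite prod_norm_lt => /andP.
by apply: measurableI; apply: measurable_set_ltr => //;
  apply: (measurableT_comp (@normr_measurable R setT)).
Qed.

Lemma measurable_fun_prodB (f g : T -> R * R) : measurable_fun setT f ->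
  measurable_fun setT g -> measurable_fun setT (fun x => f x - g x).
Proof.
move=> /measurable_fun_pairP[f1 f2] /measurable_fun_pairP[g1 g2].
by apply/measurable_fun_pairP; split; apply: measurable_funB.
Qed.

Lemma measurable_gpos (f : T -> mpoint R) t : 0 <= t -> measurable_fun setT f ->
  measurable_fun setT (fun x => gpos (f x) t).
Proof.
move=> t0 mf; have [/measurable_fun_pairP[f1 f2] f3] := (measurable_fun_pairP f).1 mf.
have /measurable_fun_pairP[h1 h2] := measurableT_comp (measurable_path_eval t0) f3.
by apply/measurable_fun_pairP; split; apply: measurable_funD.
Qed.

End param.

Lemma measurable_visits n m : measurable (@visits R n m).
Proof.
rewrite (_ : visits n m = \bigcup_r [set q : mpoint R | 0 <= (ratr r : R) <= m%:R /\
  `|gpos q (ratr r)| < n%:R]); last first.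
  by apply/seteqP; split => q [r]; [exists r|move=> _; exists r].
apply: bigcupT_measurable_rat => r.
have [r0|r0] := boolP (0 <= (ratr r : R) <= m%:R); last first.
  by rewrite (_ : mkset _ = set0)//; apply/seteqP; split => // q [].
rewrite (_ : mkset _ = [set q : mpoint R | `|gpos q (ratr r)| < n%:R]).
  apply: measurable_set_norm_lt; apply: measurable_gpos => //.
  by case/andP: r0.
by apply/seteqP; split => // q [].
Qed.

Lemma locally_finiteE : [set S : conf R | locally_finite S] =
  \bigcap_n \bigcap_m [set S | (mcount (visits n m) S < +oo)%E].
Proof.
apply/seteqP; split => S /= H n.
  by move=> _ m _ /=; apply/counting_ltoo; exact: H.
by move=> m; apply/counting_ltoo; exact: H.
Qed.

Lemma measurable_locally_finite : measurable [set S : conf R | locally_finite S].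
Proof.
rewrite locally_finiteE; do 2 apply: bigcapT_measurable => ?.
by apply: measurable_set_lte => //; apply: measurable_mcount; exact: measurable_visits.
Qed.

(** With horizon 0, [visits] looks only at starting points: these are cylinders over balls
    exhausting the plane. *)
Let V (n : nat) := @visits R n 0.

Let mV n : measurable (V n). Proof. exact: measurable_visits. Qed.

Let VE n p : V n p <-> `|p.1| < n%:R.
Proof.
have p0 : gpos p 0 = p.1 by rewrite /gpos path_at0 addr0.
split; last first.
  by move=> pn; exists 0; rewrite rmorph0 p0 lexx.
by move=> [r []]; rewrite -eq_le => /eqP <-; rewrite p0.
Qed.

Let VT : \bigcup_n V n = setT.
Proof.
apply/seteqP; split => // p _; exists (Num.truncn `|p.1|).+1 => //.
by apply/VE; exact: truncnS_gt.
Qed.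

Let ndV : {homo V : m n / (m <= n)%N >-> m `<=` n}.
Proof.
move=> m n mn p /VE pm; apply/VE; apply: lt_le_trans pm _.
by rewrite ler_nat.
Qed.

Let VS S : locally_finite S -> count_finite V S.
Proof. by move=> fS n; apply/counting_ltoo; exact: fS. Qed.

Lemma measurable_exists_point dz (Z : measurableType dz)
    (F : set ((Z * conf R) * mpoint R)) : measurable F ->
  measurable [set x : Z * conf R | locally_finite x.2 /\
    exists2 q, mconf_set x.2 q & F (x, q)].
Proof.
move=> mF; rewrite (_ : mkset _ = (snd @^-1` [set S | locally_finite S]) `&`
   [set x : Z * conf R | count_finite V x.2 /\ exists2 q, mconf_set x.2 q & F (x, q)]).
  apply: measurableI; last exact: measurable_exists_mark mF.
  rewrite -[X in measurable X]setTI; apply: measurable_snd => //.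
  exact: measurable_locally_finite.
apply/seteqP; split => x /= [fx].
  by move=> H; split => //; split => //; exact: VS.
by move=> [].
Qed.

Lemma measurable_count_points (F : set (conf R * mpoint R)) : measurable F ->
  measurable_fun [set S : conf R | locally_finite S]
    (fun S => mcount (xsection F S) S).
Proof.
move=> mF.
have mf : measurable_fun setT (fun S : conf R => (tt, S)).
  exact: measurable_fun_pair.
have mF' : measurable [set y : (unit * conf R) * mpoint R | F (y.1.2, y.2)].
  rewrite -[X in measurable X]setTI.
  have mg : measurable_fun setT (fun y : (unit * conf R) * mpoint R => (y.1.2, y.2)).
    apply: measurable_fun_pair => //.
    exact: (measurableT_comp measurable_snd measurable_fst).
  exact: mg.
have := measurable_mcount_section mV VT ndV mF'.
move=> H _ B mB.
rewrite (_ : _ `&` _ = [set S | locally_finite S] `&` ((fun S : conf R => (tt, S)) @^-1`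
   ([set x : unit * conf R | count_finite V x.2] `&` (fun x : unit * conf R =>
    mcount (xsection [set y : (unit * conf R) * mpoint R | F (y.1.2, y.2)] x) x.2) @^-1` B))).
  apply: measurableI; first exact: measurable_locally_finite.
  rewrite -[X in measurable X]setTI; apply: mf => //; apply: H => //.
  rewrite -[X in measurable X]setTI; apply: measurable_snd => //.
  exact: measurable_count_finite.
have sE S : xsection F S =
    xsection [set y : (unit * conf R) * mpoint R | F (y.1.2, y.2)] (tt, S).
  by apply/seteqP; split => q /xsectionP /= h; apply/xsectionP.
apply/seteqP; split => S /= [fS].
  by rewrite sE => SB; split => //; split => //; exact: VS.
by move=> [_]; rewrite -sE.
Qed.

(* Measurability of the iterates is only clear on locally finite configurations. *)
Definition lf_iterates n (x : mpoint R * conf R) : \bar R :=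
  if `[< locally_finite x.2 >] then iterates x.2 n x.1 else +oo%E.

(** By [Phi_leP], [Phi <= a] says that the configuration contains a point satisfying a countable
    combination of conditions, one of which evaluates the previous iterate at that very point. Joint
    measurability in the point and the configuration is therefore what passes through the
    induction. *)
Lemma measurable_lf_iterates n : measurable_fun setT (lf_iterates n).
Proof.
elim: n => [|n IH].
  rewrite (_ : lf_iterates 0 = cst +oo%E)//.
  by apply/funext => x; rewrite /lf_iterates; case: ifP.
apply: measurable_fun_le_ereal => a.
have [a0|a0] := ltP a 0.
  rewrite (_ : mkset _ = set0)//; apply/seteqP; split => // x /=.
  rewrite /lf_iterates; case: ifP => // _ H.
  have := le_trans (iterates_ge0 x.2 n.+1 x.1) H.
  by rewrite lee_fin leNgt a0.
pose N (e : R) (u v : rat) : set ((mpoint R * conf R) * mpoint R) :=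
  [set y | [/\ 0 <= ratr u :> R, 0 <= ratr v :> R, ratr u <= ratr v + e & ratr v <= a + e]] `&`
  ([set y | ((ratr u - e)%:E < lf_iterates n (y.2, y.1.2))%E] `&`
   [set y | `|gpos y.1.1 (ratr v) - gpos y.2 (ratr u)| < e]).
pose F : set ((mpoint R * conf R) * mpoint R) :=
  [set y | y.2.1 <> y.1.1.1] `&` \bigcap_k \bigcup_u \bigcup_v N (inv_succ k) u v.
have m11 : measurable_fun setT (fun y : (mpoint R * conf R) * mpoint R => y.1.1).
  exact: (measurableT_comp measurable_fst measurable_fst).
have m12 : measurable_fun setT (fun y : (mpoint R * conf R) * mpoint R => y.1.2).
  exact: (measurableT_comp measurable_snd measurable_fst).
have m2 : measurable_fun setT (fun y : (mpoint R * conf R) * mpoint R => y.2).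
  exact: measurable_snd.
have mN e u v : measurable (N e u v).
  have [u0|u0] := boolP (0 <= ratr u :> R); last first.
    rewrite (_ : N _ _ _ = set0)//; apply/seteqP; split => // y [[u0' _ _ _] _].
    by rewrite u0' in u0.
  have [v0|v0] := boolP (0 <= ratr v :> R); last first.
    rewrite (_ : N _ _ _ = set0)//; apply/seteqP; split => // y [[_ v0' _ _] _].
    by rewrite v0' in v0.
  apply: measurableI; first exact: measurable_set_cst.
  apply: measurableI.
    apply: measurable_set_lte => //; apply: (measurableT_comp IH).
    exact: measurable_fun_pair.
  by apply/measurable_set_norm_lt/measurable_fun_prodB; exact: measurable_gpos.
have mF : measurable F.
  apply: measurableI; last first.
    by apply: bigcapT_measurable => k; do 2 apply: bigcupT_measurable_rat => ?.
  rewrite (_ : mkset _ = ~` \bigcap_k [set y : (mpoint R * conf R) * mpoint R |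
      `|y.2.1 - y.1.1.1| < inv_succ k]).
    apply/measurableC/bigcapT_measurable => k; apply/measurable_set_norm_lt.
    apply: measurable_fun_prodB; [exact: (measurableT_comp measurable_fst m2)|].
    exact: (measurableT_comp measurable_fst m11).
  apply/seteqP; split => y /= H.
    move=> Hk; apply: H; apply/eqP; rewrite -subr_eq0 -normr_eq0 eq_le normr_ge0 andbT.
    rewrite leNgt; apply/negP => /inv_small[k /(_ k (leqnn _))].
    by rewrite ltNge ltW// Hk.
  by move=> E; apply: H => k _ /=; rewrite E subrr normr0; exact: inv_succ_gt0.
have := measurable_exists_point mF; congr measurable.
apply/seteqP; split => x /=.
  move=> [fS [q Sq [qx H]]]; rewrite /lf_iterates asboolT// iteratesS.
  apply/Phi_leP => //; exists q => // k.
  have [u _ [v _ [H1 [/= H2 H3]]]] := H k I.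
  by exists u, v; move: H2; rewrite /lf_iterates /= asboolT.
rewrite /lf_iterates; case: asboolP => // fS; rewrite iteratesS => /Phi_leP[]// q [Sq qx] H.
split => //; exists q => //; split => // k _.
have [u [v /= [H1 [H2 H3]]]] := H k.
by exists u => //; exists v => //; split => //; split => //=; rewrite /lf_iterates /= asboolT.
Qed.

Definition lf_upper_time (x : mpoint R * conf R) : \bar R :=
  ereal_inf [set lf_iterates n.*2 x | n in setT].

Definition lf_lower_time (x : mpoint R * conf R) : \bar R :=
  ereal_sup [set lf_iterates n.*2.+1 x | n in setT].

Lemma lf_upper_timeE p S : locally_finite S -> lf_upper_time (p, S) = upper_time S p.
Proof.
move=> fS; congr ereal_inf; apply: eq_imagel => n _.
by rewrite /lf_iterates asboolT.
Qed.

Lemma lf_lower_timeE p S : locally_finite S -> lf_lower_time (p, S) = lower_time S p.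
Proof.
move=> fS; congr ereal_sup; apply: eq_imagel => n _.
by rewrite /lf_iterates asboolT.
Qed.

Definition determined : set (conf R) := [set S | locally_finite S /\
  forall p, mconf_set S p -> lower_time S p = upper_time S p].

Lemma measurable_determined : measurable determined.
Proof.
have m1 : measurable_fun setT (fun y : (unit * conf R) * mpoint R => (y.2, y.1.2)).
  by apply: measurable_fun_pair => //; exact: (measurableT_comp measurable_snd measurable_fst).
have mF : measurable [set y : (unit * conf R) * mpoint R |
    (lf_lower_time (y.2, y.1.2) < lf_upper_time (y.2, y.1.2))%E].
  apply: measurable_set_lte.
    by apply: (measurableT_comp _ m1); apply: measurable_fun_ereal_sup => n;
      exact: measurable_lf_iterates.
  by apply: (measurableT_comp _ m1); apply: measurable_fun_ereal_inf => n;
    exact: measurable_lf_iterates.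
rewrite (_ : determined = [set S | locally_finite S] `&` ~` ((fun S : conf R => (tt, S)) @^-1`
  [set x : unit * conf R | locally_finite x.2 /\ exists2 q, mconf_set x.2 q &
   (lf_lower_time (q, x.2) < lf_upper_time (q, x.2))%E])).
  apply: measurableI; first exact: measurable_locally_finite.
  apply: measurableC; rewrite -[X in measurable X]setTI.
  have mf : measurable_fun setT (fun S : conf R => (tt, S)).
    exact: measurable_fun_pair.
  by apply: mf => //; have := measurable_exists_point mF.
apply/seteqP; split => S /= [fS H]; split => //.
  move=> [_ [q /H E]]; rewrite lf_lower_timeE// lf_upper_timeE// E.
  by rewrite ltxx.
move=> p Sp; apply/eqP; rewrite eq_le lower_le_upper_time leNgt; apply/negP => LU.
by apply: H; split => //; exists p; rewrite // lf_lower_timeE// lf_upper_timeE.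
Qed.

Lemma counting_image (T T' : pointedType) (f : T -> T') (A : set T) :
  {in A &, injective f} -> @counting T' R (f @` A) = counting A.
Proof.
move=> /inj_card_eq ce; rewrite /counting (eq_finite_set ce).
case: asboolP => // fA; congr (_%:R%:E); apply/fcard_eq => //.
by rewrite (eq_finite_set ce).
Qed.

(** On [determined] the graph has as many points in [B] as [S] has points [p] with
    [(p.1, upper_time S p)] in [B], distinct points having distinct positions; the latter count is
    measurable. *)
Lemma measurable_lifetime_graph : measurable_fun determined (@lifetime_graph R).
Proof.
apply: (measurability (\bigcup_(A in measurable) preimage_set_system setT
  (mcount A : hat_conf R -> \bar R) measurable)) => //.
move=> _ [_ [B mB [C mC <-]] <-]; rewrite setTI.
pose F : set (conf R * mpoint R) := [set x | B (x.2.1, lf_upper_time (x.2, x.1))].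
have m2 : measurable_fun setT (fun x : conf R * mpoint R => x.2.1).
  exact: (measurableT_comp measurable_fst measurable_snd).
have mF : measurable F.
  rewrite -[X in measurable X]setTI.
  have mf : measurable_fun setT (fun x : conf R * mpoint R =>
      (x.2.1, lf_upper_time (x.2, x.1))).
    apply: measurable_fun_pair => //.
    have mU : measurable_fun setT lf_upper_time.
      by apply: measurable_fun_ereal_inf => n; exact: measurable_lf_iterates.
    by apply: (measurableT_comp mU); exact: measurable_fun_pair.
  exact: mf.
have mH := measurable_count_points mF measurable_locally_finite mC.
have graphE S : determined S -> mcount B (lifetime_graph S) = mcount (xsection F S) S.
  move=> [fS HS]; have [_ lE] := lower_eq_upper_tempered fS HS.
  rewrite /mcount; set A := mconf_set S `&` _.
  rewrite (_ : _ `&` B = (fun p : mpoint R => (p.1, lifetime S p.1)) @` A).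
    apply: counting_image => p q; rewrite !inE => -[Sp _] [Sq _] /= [pq _].
    exact: (mconf_inj Sp Sq pq).
  apply/seteqP; split => [_ [[_ [p Sp <-] <-] Bp]|_ [p [Sp /xsectionP Fp] <-]].
    exists p => //; split => //; apply/xsectionP; rewrite /F /=.
    by rewrite lf_upper_timeE// -lE.
  split; last by move: Fp; rewrite /F /= lf_upper_timeE// -lE.
  by exists p.1 => //; exists p.
rewrite (_ : _ `&` _ = determined `&` ([set S | locally_finite S] `&`
    (fun S => mcount (xsection F S) S) @^-1` C)); last first.
  apply/seteqP; split => S [dS] /=.
    by rewrite graphE// => SC; split => //; split => //; case: dS.
  by rewrite graphE// => -[].
exact: measurableI measurable_determined mH.
Qed.

Section translation.
Variables (u : R * R) (S : conf R).

Let shift (p : mpoint R) : mpoint R := (p.1 - u, p.2).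

Let gpos_shift p t : gpos (shift p) t = gpos p t - u.
Proof. by rewrite /gpos /shift /= addrAC. Qed.

Lemma translate_locally_finite : locally_finite S -> locally_finite (translate u S).
Proof.
move=> fS n m.
have fi := finite_image shift (fS (n + (Num.truncn `|u|).+1)%N m).
apply: sub_finite_set fi => _ [[p Sp <-] [r [rm rn]]]; exists p => //; split => //.
exists r; split => //; rewrite gpos_shift in rn.
rewrite -(subrK u (gpos p (ratr r))); apply: le_lt_trans (ler_normD _ _) _.
by rewrite natrD ltrD// truncnS_gt.
Qed.

Let iterates_shift n p : iterates (translate u S) n (shift p) = iterates S n p.
Proof.
elim: n p => [//|n IH] p; rewrite !iteratesS /Phi; congr ereal_inf.
apply: eq_set => b; apply/propext; split => -[t [t0 [q [s [Sq qp st sq pq]]]] <-];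
  exists t => //; split => //.
  case: Sq => q' Sq' E; rewrite -E in qp sq pq.
  exists q', s; split => //.
  - by move=> e; apply: qp; rewrite /shift /= e.
  - by rewrite -IH.
  - by move: pq; rewrite (gpos_shift p) (gpos_shift q') => /subIr.
exists (shift q), s; split => //.
- by exists q.
- by move=> /subIr.
- by rewrite IH.
- by rewrite !gpos_shift pq.
Qed.

Lemma translate_determined : determined S -> determined (translate u S).
Proof.
move=> [fS HS]; split; first exact: translate_locally_finite.
move=> _ [p Sp <-]; rewrite -/(shift p).
have -> : lower_time (translate u S) (shift p) = lower_time S p.
  by congr ereal_sup; apply: eq_imagel => n _; exact: iterates_shift.
have -> : upper_time (translate u S) (shift p) = upper_time S p.
  by congr ereal_inf; apply: eq_imagel => n _; exact: iterates_shift.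
exact: HS.
Qed.

End translation.

Lemma determined_tempered_set : tempered_set determined.
Proof.
split.
- exact: measurable_determined.
- by move=> S [fS HS]; have [] := lower_eq_upper_tempered fS HS.
- by move=> u S; exact: translate_determined.
- exact: measurable_lifetime_graph.
Qed.

End path_measurability.

(* The cell of the square lattice where a path is at the beginning of a window, and
   its oscillation during the window rounded down, in units of the mesh. *)
Definition site : Type := ((int * int) * nat)%type.

(** * Deterministic geometry of chains and crossings *)

Section percolation.
Implicit Types (c z : int * int) (u v w t : site) (n al : nat) (V Q O : site -> Prop).
Local Open Scope nat_scope.

Definition near_cell c z n : bool := [&& (c.1 <= z.1 + n%:Z)%R, (z.1 <= c.1 + n%:Z)%R,
  (c.2 <= z.2 + n%:Z)%R & (z.2 <= c.2 + n%:Z)%R].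

Lemma near_cell_le c z n m : n <= m -> near_cell c z n -> near_cell c z m.
Proof. by rewrite /near_cell; lia. Qed.

(** The [+ 2] makes up for rounding down the two oscillations. *)
Definition linked u v := near_cell u.1 v.1 (u.2 + v.2 + 2).

Inductive chain V : site -> site -> Prop :=
| chain_refl u : V u -> chain V u u
| chain_step u v w : chain V u v -> linked v w -> V w -> chain V u w.

Lemma chain_sub V V' u v : (forall w, V w -> V' w) -> chain V u v -> chain V' u v.
Proof.
move=> VV'; elim=> [w Vw|u' v' w' _ IH vw Vw]; first exact/chain_refl/VV'.
exact: chain_step IH vw (VV' _ Vw).
Qed.

Lemma chain_target V u v : chain V u v -> V v.
Proof. by case. Qed.

(** The chain is cut at its first exit from [Q]; both pieces are kept, the first to stay inside [Q],
    the second to start afresh from [w']. *)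
Lemma chain_exit V Q u v : chain V u v -> Q u -> ~ Q v ->
  exists w w', [/\ chain (fun x => V x /\ Q x) u w, linked w w', ~ Q w' & chain V w' v].
Proof.
move=> uv Qu nQv.
suff [/chain_target[]//|] : chain (fun x => V x /\ Q x) u v \/
    exists w w', [/\ chain (fun x => V x /\ Q x) u w, linked w w', ~ Q w' & chain V w' v].
  by [].
elim: uv Qu {nQv} => [x Vx Qx|x y x' _ IH yx' Vx' Qx]; first by left; exact: chain_refl.
have [xy|[w [w' [xw ww' nQ w'y]]]] := IH Qx; last first.
  by right; exists w, w'; split => //; exact: chain_step w'y yx' Vx'.
have [Qx'|nQ] := pselect (Q x'); first by left; exact: chain_step xy yx' _.
by right; exists y, x'; split => //; exact: chain_refl.
Qed.

(** The bounds on position and level make a crossing depend on finitely many sites, at the price of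
    controlling larger grains separately. *)
Definition crossing O z al := exists t t', [/\ near_cell t.1 z al, ~~ near_cell t'.1 z (2 * al) &
  chain (fun u => [/\ O u, near_cell u.1 z (3 * al) & u.2 < al]) t t'].

(** The bound on the levels limits every jump to [al], so that the first exit from radius [2 al]
    lands within [3 al]. *)
Lemma chain_crossing O V z al v v' : (forall u, V u -> O u /\ 2 * u.2 + 2 <= al) ->
  chain V v v' -> near_cell v.1 z al -> ~~ near_cell v'.1 z (2 * al) -> crossing O z al.
Proof.
move=> VO vv' vz /negP v'z.
have vz2 : near_cell v.1 z (2 * al) by move: vz; rewrite /near_cell; lia.
have [w [w' [vw ww' /negP w'z w'v']]] :=
  chain_exit (Q := fun u => near_cell u.1 z (2 * al)) vv' vz2 v'z.
have Vw' : V w' by elim: w'v' {ww' w'z}.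
have [Vw wz] := chain_target vw.
have [_ lw] := VO w Vw; have [Ow' lw'] := VO w' Vw'.
exists v, w'; split => //; apply: chain_step (ww') _.
  apply: chain_sub vw => x [Vx xz]; have [Ox lx] := VO x Vx; split => //; last by lia.
  by move: xz; rewrite /near_cell; lia.
split => //; last by lia.
by move: ww' wz; rewrite /linked /near_cell; lia.
Qed.

(** The shifts by 40 make the indices run from -40 to 40, in steps of [al], over the box of radius
    [40 al]. *)
Definition grid_cell z al (k : 'I_81 * 'I_81) : int * int :=
  (z.1 + al%:Z * (k.1%:Z - 40), z.2 + al%:Z * (k.2%:Z - 40))%R.

Lemma grid_near z al c : 0 < al -> near_cell c z (40 * al) ->
  exists k, near_cell c (grid_cell z al k) al.
Proof.
move=> al0.
have H (x y : int) : (x <= y + (40 * al)%N%:Z)%R -> (y <= x + (40 * al)%N%:Z)%R ->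
    exists k : 'I_81, (x <= y + al%:Z * (k%:Z - 40) + al%:Z)%R /\
      (y + al%:Z * (k%:Z - 40) <= x + al%:Z)%R.
  move=> xy yx; pose n := absz (x - y + (40 * al)%N%:Z)%R.
  have nE : (x - y + (40 * al)%N%:Z = n%:Z)%R by rewrite /n; lia.
  have dE := divn_eq n al; have rl := ltn_pmod n al0.
  set q := n %/ al in dE; set r := n %% al in dE rl.
  have q81 : q < 81 by nia.
  exists (Ordinal q81) => /=; split; nia.
case/and4P => h1 h2 h3 h4.
have [k [k1 k2]] := H _ _ h1 h2; have [l [l1 l2]] := H _ _ h3 h4.
by exists (k, l); apply/and4P; split => /=.
Qed.

Lemma crossing_scale O z al : 0 < al -> crossing O z (20 * al) ->
  (forall u, O u -> near_cell u.1 z (60 * al) -> 2 * u.2 + 2 <= al) ->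
  exists k l, [/\ crossing O (grid_cell z al k) al, crossing O (grid_cell z al l) al &
    forall c, near_cell c (grid_cell z al k) (3 * al) ->
      ~~ near_cell c (grid_cell z al l) (3 * al)].
Proof.
move=> al0 [t [t' [tz t'z tt']]] small.
set V := (fun u => [/\ O u, _ & _]) in tt'.
have VO u : V u -> O u /\ 2 * u.2 + 2 <= al.
  move=> [Ou uz _]; split => //; apply: small => //; rewrite (_ : 60 * al = 3 * (20 * al))//; lia.
(* The chain exits the boxes of radii 20 al and 29 al around z; from each exit point
   starts a crossing at scale al. *)
have cross n : 20 <= n <= 36 -> exists k v, [/\ ~~ near_cell v.1 z (n * al),
    near_cell v.1 z (n.+1 * al), near_cell v.1 (grid_cell z al k) al &
    crossing O (grid_cell z al k) al].
  move=> /andP[n20 n36].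
  have tzn : near_cell t.1 z (n * al) by move: tz; rewrite /near_cell; nia.
  have t'zn : ~ near_cell t'.1 z (n * al) by apply/negP; move: t'z; rewrite /near_cell; nia.
  have [w [w' [tw ww' /negP w'z w't']]] :=
    chain_exit (Q := fun u => near_cell u.1 z (n * al)) tt' tzn t'zn.
  have Vw' : V w' by elim: w't' {ww' w'z}.
  have [Vw wz] := chain_target tw.
  have [_ lw] := VO w Vw; have [Ow' lw'] := VO w' Vw'.
  have w'zn : near_cell w'.1 z (n.+1 * al).
    by move: ww' wz; rewrite /linked /near_cell; nia.
  have [k kP] : exists k, near_cell w'.1 (grid_cell z al k) al.
    by apply: grid_near => //; move: w'zn; rewrite /near_cell; nia.
  exists k, w'; split => //; apply: (chain_crossing VO w't') => //.
  (* Here [n <= 36] matters: the grid cell is within [38 al] of [z], so its box of radius [2 al]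
     stays within [40 al], beyond which the chain ends. *)
  have w'z37 : near_cell w'.1 z (37 * al).
    by apply: near_cell_le w'zn; rewrite leq_mul2r ltnS n36 orbT.
  move: t'z w'z37 kP; rewrite /near_cell; set g := grid_cell _ _ _; lia.
(* The exit points are at distance at most [21 al], respectively more than [29 al]; grid cells shift
   them by at most [al] and the boxes reach [3 al] further, so that the distance [25 al] separates
   the boxes. *)
have [k [v [_ v1 v2 v3]]] := cross 20 isT.
have [l [w [w0 w1 w2 w3]]] := cross 29 isT.
exists k, l; split => // c; move: w0 w2 v1 v2; rewrite /near_cell.
by set g := grid_cell _ _ _; set g' := grid_cell _ _ _; lia.
Qed.

(** Absence of a crossing does not control sites outside the box, which could be linked to it if
    large; the growth condition does. At the first exit from radius [2 al], to a site at distance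
    [n], it gives [n <= 2 al + al / 4 + n / 8], hence [n <= 3 al], and the chain would be a
    crossing. *)
Lemma chain_confined O al t t' : ~ crossing O (0, 0)%R al ->
  (forall u n, O u -> al <= n -> near_cell u.1 (0, 0)%R n -> 8 * u.2 + 8 <= n) ->
  chain O t t' -> near_cell t.1 (0, 0)%R al -> near_cell t'.1 (0, 0)%R (2 * al).
Proof.
move=> ncr small tt' t0; apply: contrapT => t'0.
have t0' : near_cell t.1 (0, 0)%R (2 * al) by move: t0; rewrite /near_cell /=; lia.
have [w [w' [tw ww' /negP w'z w't']]] :=
  chain_exit (Q := fun u => near_cell u.1 (0, 0)%R (2 * al)) tt' t0' t'0.
have Ow' : O w' by elim: w't' {ww' w'z}.
have [Ow wz] := chain_target tw.
have sw : 8 * w.2 + 8 <= 2 * al by apply: small => //; lia.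
pose n := maxn (absz w'.1.1) (absz w'.1.2).
have sw' : 8 * w'.2 + 8 <= n.
  apply: small => //; rewrite /n; move: w'z; rewrite /near_cell /=; lia.
have w'n : near_cell w'.1 (0, 0)%R (3 * al).
  by move: ww' wz sw'; rewrite /linked /near_cell /= /n; lia.
have n3 : n <= 3 * al by move: w'n; rewrite /near_cell /= /n; lia.
apply: ncr; exists t, w'; split => //; apply: chain_step ww' _; last by split => //; lia.
apply: chain_sub tw => x [Ox xz]; split => //.
  by move: xz; rewrite /near_cell /=; lia.
by have := small x (2 * al) Ox _ xz; lia.
Qed.

End percolation.

(** * From paths to sites *)

Section sites.
Context {R : realType}.
Implicit Types (p q : mpoint R) (S : conf R) (h : path_space R) (s t a b c : R).

Definition oscillation a b h : R := sup [set `|h s - h a| | s in [set s | a <= s <= b]].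

Lemma oscillation_has_sup a b h : 0 <= a <= b ->
  has_sup [set `|h s - h a| | s in [set s | a <= s <= b]].
Proof.
move=> /andP[a0 ab]; split; first by exists `|h a - h a|, a => //=; rewrite lexx.
have [B _ HB] := path_bounded h b.
exists (B + B) => _ [s /= /andP[sa sb] <-]; apply: le_trans (ler_normB _ _) _.
by apply: lerD; apply/ltW/HB; rewrite ?a0 ?ab ?sb ?(le_trans a0).
Qed.

Lemma le_oscillation a b h s : 0 <= a -> a <= s <= b -> `|h s - h a| <= oscillation a b h.
Proof.
move=> a0 /andP[sa sb]; apply: sup_upper_bound.
  by apply: oscillation_has_sup; rewrite a0 (le_trans sa).
by exists s => //=; rewrite sa.
Qed.

Lemma oscillation_ge0 a b h : 0 <= a <= b -> 0 <= oscillation a b h.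
Proof.
by move=> /andP[a0 ab]; apply: le_trans (le_oscillation h a0 (s := a) _); rewrite ?lexx.
Qed.

Lemma oscillation_le a b h c : 0 <= a <= b ->
  (forall s, a <= s <= b -> `|h s - h a| <= c) -> oscillation a b h <= c.
Proof.
move=> ab H; apply: ge_sup; last by move=> _ [s /= sab <-]; exact: H.
by have [] := oscillation_has_sup h ab.
Qed.

(** By continuity the times [a + (b - a) * r], with [r] rational in [[0, 1]], suffice; they are
    dense in the window even when its ends are irrational. *)
Lemma measurable_oscillation a b : 0 <= a < b ->
  measurable_fun setT (oscillation a b).
Proof.
move=> /andP[a0 ab]; apply/measurable_EFinP; apply: measurable_fun_le_ereal => c.
rewrite (_ : mkset _ = \bigcap_(r : rat) [set h : path_space R |
    0 <= (ratr r : R) <= 1 -> `|h (a + (b - a) * ratr r) - h a| <= c]).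
  rewrite -[X in measurable X]setCK setC_bigcap.
  apply/measurableC/bigcupT_measurable_rat => r; apply: measurableC.
  have [r01|r01] := boolP (0 <= (ratr r : R) <= 1); last first.
    by rewrite (_ : mkset _ = setT)//; apply/seteqP; split.
  rewrite (_ : mkset _ = ~` \bigcup_k [set h : path_space R | ~ (`|h (a + (b - a) * ratr r) - h a| < c + inv_succ k)]).
    apply/measurableC/bigcupT_measurable => k; apply: measurableC.
    apply: measurable_set_norm_lt; apply: measurable_fun_prodB; apply: measurable_path_eval => //.
    by case/andP: r01 => r0 _; rewrite addr_ge0// mulr_ge0// subr_ge0 ltW.
  apply/seteqP; split => h /=.
    move=> H [k _]; apply; apply: le_lt_trans (H _) _ => //.
    by rewrite ltrDl inv_succ_gt0.
  move=> H _; apply/ler_addgt0Pr => e /inv_small[k /(_ k (leqnn _)) ke].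
  rewrite leNgt; apply/negP => hc; apply: H; exists k => //; apply/negP.
  by rewrite -leNgt ltW// (le_lt_trans _ hc)// lerD2l ltW.
apply/seteqP; split => h /=.
  rewrite lee_fin => H r _ r01; apply: le_trans H; apply: le_oscillation => //.
  have ba : 0 <= b - a by rewrite subr_ge0 ltW.
  case/andP: r01 => r0 r1.
  by rewrite lerDl mulr_ge0//= -lerBrDl ler_piMr.
move=> H; rewrite lee_fin; apply: oscillation_le; first by rewrite a0 ltW.
move=> s /andP[sa sb]; apply/ler_addgt0Pr => e e0.
have s0 : 0 <= s by exact: le_trans sa.
have [dl dl0 Hd] := path_continuousP h s0 e0.
have ba : 0 < b - a by rewrite subr_gt0.
have [r /andP[r1 r2]] : exists r : rat,
    (Num.max a (s - dl) - a) / (b - a) < ratr r < (Num.min b (s + dl) - a) / (b - a).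
  apply: rat_between; rewrite ltr_pM2r ?invr_gt0// ltrD2r lt_min !gt_max.
  by rewrite ab ltrBlDr; apply/andP; split; apply/andP; split; lra.
move: r1 r2; rewrite ltr_pdivrMr// ltr_pdivlMr// ltrBlDl ltrBrDl [ratr r * _]mulrC.
rewrite gt_max lt_min => /andP[ar sr] /andP[rb rs].
have r01 : 0 <= (ratr r : R) <= 1.
  move: ar rb; rewrite ltrDl pmulr_rgt0// => /ltW -> /=.
  by rewrite addrC -ltrBrDr -[X in _ < X]mulr1 ltr_pM2l// => /ltW.
set s' := a + _ in ar sr rb rs.
have ss' : `|h s' - h s| < e.
  by apply: Hd; [rewrite (le_trans a0)// ltW|rewrite ltr_norml; lra].
apply: le_trans (ler_distD (h s') _ _) _; rewrite addrC; apply: lerD.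
  exact: H.
by rewrite distrC ltW.
Qed.

Definition site_of (l a b : R) p : site :=
  ((Num.floor ((gpos p a).1 / l), Num.floor ((gpos p a).2 / l)),
   Num.truncn (oscillation a b p.2 / l)).

Definition occupied (l a b : R) S (u : site) := exists2 p, mconf_set S p & site_of l a b p = u.

Lemma floor_near (l x y : R) (n : nat) : 0 < l -> `|x - y| < n%:R * l ->
  (Num.floor (x / l) <= Num.floor (y / l) + n%:Z)%R.
Proof.
move=> l0; rewrite ltr_norml => /andP[_ xy].
rewrite -lerBlDr floor_ge_int rmorphB/= lerBlDr.
apply: le_trans (floor_le _) _; rewrite -lerBlDl -mulrBl ler_pdivrMr//.
exact: ltW.
Qed.

Lemma oscillation_lt_level l a b p : 0 < l ->
  oscillation a b p.2 < (site_of l a b p).2.+1%:R * l.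
Proof. by move=> l0; rewrite -ltr_pdivrMr//; exact: truncnS_gt. Qed.

(** Since time [a] each path has moved by less than its level plus 1, in units of the mesh; the
    distance at time [a] is below the sum of the two. *)
Lemma meet_linked l a b p q s t : 0 < l -> 0 <= a -> a <= s <= b -> a <= t <= b ->
  gpos p t = gpos q s -> linked (site_of l a b p) (site_of l a b q).
Proof.
move=> l0 a0 sab tab pq; set m := ((site_of l a b p).2 + (site_of l a b q).2 + 2)%N.
have H : `|gpos p a - gpos q a| < m%:R * l.
  have -> : gpos p a - gpos q a = (q.2 s - q.2 a) - (p.2 t - p.2 a).
    have <- : gpos q s - gpos q a = q.2 s - q.2 a by rewrite /gpos opprD addrACA subrr add0r.
    have <- : gpos p t - gpos p a = p.2 t - p.2 a by rewrite /gpos opprD addrACA subrr add0r.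
    by rewrite pq opprB [RHS]addrC subrKA.
  apply: le_lt_trans (ler_normB _ _) _.
  rewrite (_ : m%:R * l = (site_of l a b q).2.+1%:R * l + (site_of l a b p).2.+1%:R * l).
    by apply: ltrD; apply: le_lt_trans (le_oscillation _ a0 _) (oscillation_lt_level _ _ _ _).
  by rewrite -mulrDl -natrD; congr (_%:R * _); rewrite /m; lia.
move: (H); rewrite distrC => H'.
move: H H'; rewrite !prod_norm_lt => /andP[h1 h2] /andP[h3 h4].
by apply/and4P; split; apply: floor_near.
Qed.

Lemma near_cell_norm l a b p (n : nat) : 0 < l ->
  near_cell (site_of l a b p).1 (0, 0) n -> `|gpos p a| < n.+1%:R * l.
Proof.
have H (x : R) : 0 < l -> (Num.floor (x / l) <= 0 + n%:Z)%R ->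
    (0 <= Num.floor (x / l) + n%:Z)%R -> `|x| < n.+1%:R * l.
  move=> l0 h1 h2; rewrite ltr_norml -mulNr -(ltr_pdivlMr _ _ l0) -(ltr_pdivrMr _ _ l0).
  have := floor_le (x / l); have := floorD1_gt (x / l).
  move: (Num.floor (x / l)) h1 h2 => f h1 h2 xf fx.
  have f1 : f + 1 <= n.+1%:Z by lia.
  have f2 : - n.+1%:Z < f by lia.
  move: f1 f2; rewrite -(ler_int R) -(ltr_int R) rmorphN /= => f1 f2.
  by rewrite (lt_le_trans f2)//= (lt_le_trans xf).
move=> l0 /and4P[/= h1 h2 h3 h4]; rewrite prod_norm_lt.
by apply/andP; split; exact: H.
Qed.

(** The closed set is the cluster of [p]: all points whose sites are joined to that of [p] by a
    chain. A scale [al] large enough to contain the site of [p] confines it, and local finiteness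
    makes it finite. *)
Lemma confined_window_closed l a b S : 0 < l -> 0 <= a <= b -> locally_finite S ->
  (forall N : nat, exists2 al, (N <= al)%N & ~ crossing (occupied l a b S) (0, 0) al /\
    forall u n, occupied l a b S u -> (al <= n)%N -> near_cell u.1 (0, 0) n ->
      (8 * u.2 + 8 <= n)%N) ->
  forall p, mconf_set S p -> exists C, [/\ finite_set C, C `<=` mconf_set S, C p &
    window_closed S a b C].
Proof.
move=> l0 /andP[a0 ab] fS H p Sp; pose u := site_of l a b p.
pose N := maxn (absz u.1.1) (absz u.1.2).
have [al Nal [ncr small]] := H N.
have u0 : near_cell u.1 (0, 0) al by move: Nal; rewrite /N /near_cell /=; lia.
exists [set q | mconf_set S q /\ chain (occupied l a b S) u (site_of l a b q)]; split.
- pose n := (Num.truncn ((2 * al).+1%:R * l)).+1.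
  apply: sub_finite_set (fS n (Num.truncn a).+1) => q [Sq uq]; split => //.
  apply: (@visitsP _ q a); first by rewrite a0 truncnS_gt.
  have := near_cell_norm l0 (chain_confined ncr small uq u0).
  by move=> /lt_trans; apply; exact: truncnS_gt.
- by move=> q [].
- by split => //; apply: chain_refl; exists p.
- move=> x q [Sx ux] Sq [s [t [sab tab xq]]]; split => //.
  apply: chain_step ux (meet_linked l0 a0 sab tab xq) _.
  by exists q.
Qed.

End sites.

(** * The intensity measure *)

Section intensity_measure.
Context {R : realType}.

Let MR := measurableTypeR R.

Definition plane_measure : set (MR * MR)%type -> \bar R :=
  (@lebesgue_measure R \x @lebesgue_measure R)%E.

HB.instance Definition _ := Measure.on plane_measure.

Lemma plane_measure_box (a b c e : R) :
  plane_measure (`[a, b] `*` `[c, e]) =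
  (lebesgue_measure `[a, b] * lebesgue_measure `[c, e])%E.
Proof. by rewrite /plane_measure product_measure1E//; exact: measurable_itv. Qed.

Lemma plane_measure_box_le (a c s : R) : 0 <= s ->
  plane_measure (`[a, a + s] `*` `[c, c + s]) = (s ^+ 2)%:E.
Proof.
move=> s0; rewrite plane_measure_box !lebesgue_measure_itv /= !lte_fin !ltrDl.
rewrite lt_neqAle s0 andbT; case: eqP => [<-|_]; first by rewrite mule0 expr0n.
by rewrite -!EFinB -EFinM; congr (_%:E); rewrite ![_ + s]addrC !addrK expr2.
Qed.

Let plane_measure_sigma_finite : sigma_finite setT plane_measure.
Proof.
exists (fun n => `[- n%:R, - n%:R + (2 * n)%:R] `*` `[- n%:R, - n%:R + (2 * n)%:R]).
  apply/seteqP; split => // x _; exists (Num.truncn (Num.max `|x.1| `|x.2|)).+1 => //=.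
  have := truncnS_gt (Num.max `|x.1| `|x.2|); rewrite gt_max.
  move: (_.+1) => n /andP[]; rewrite !ltr_norml => /andP[? ?] /andP[? ?].
  have E : - n%:R + (2 * n)%:R = n%:R :> R by rewrite natrM; lra.
  by split; rewrite /= in_itv /= E; apply/andP; split; apply: ltW.
move=> n; split; first by apply: measurableX; exact: measurable_itv.
by rewrite plane_measure_box_le// ltry.
Qed.

HB.instance Definition _ := Measure_isSigmaFinite.Build _ _ _ plane_measure
  plane_measure_sigma_finite.

Variable mu : probability (path_space R) R.

Let fubini_set (A : set (mpoint R)) : measurable A ->
  intensity mu A = (\int[mu]_h plane_measure (ysection A h))%E /\
  measurable_fun setT (fun h => plane_measure (ysection A h)).
Proof.
move=> mA.
have mA' : @measurable _ ((MR * MR) * path_space R)%type A by exact: mA.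
have FE := @indic_fubini_tonelli_FE _ _ (MR * MR)%type (path_space R) R mu A mA'.
have GE := @indic_fubini_tonelli_GE _ _ (MR * MR)%type (path_space R) R plane_measure A mA'.
have H := @indic_fubini_tonelli _ _ (MR * MR)%type (path_space R) R plane_measure mu A mA'.
have mG := @indic_measurable_fun_fubini_tonelli_G _ _ (MR * MR)%type (path_space R) R
  plane_measure A mA'.
by rewrite FE GE in H; rewrite GE in mG; split.
Qed.

(** Fubini, with the path integrated last: each section lies in a square whose corner [c] may depend
    on the path, only the area being retained. *)
Lemma intensity_le (A : set (mpoint R)) (s : path_space R -> R) : measurable A ->
  measurable_fun setT s -> (forall h, 0 <= s h) ->
  (forall h, exists c : R * R, forall y, A (y, h) ->
    c.1 <= y.1 <= c.1 + s h /\ c.2 <= y.2 <= c.2 + s h) ->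
  (intensity mu A <= \int[mu]_h (s h ^+ 2)%:E)%E.
Proof.
move=> mA ms s0 H; have [-> mG] := fubini_set mA.
apply: ge0_le_integral => //.
  by apply/measurable_EFinP; exact: measurable_funX.
move=> h _; have [c Hc] := H h; rewrite -(plane_measure_box_le c.1 c.2 (s0 h)).
apply: le_measure; rewrite ?inE.
- have mA' : @measurable _ ((MR * MR) * path_space R)%type A by exact: mA.
  exact: measurable_ysection.
- by apply: measurableX; exact: measurable_itv.
- move=> y; rewrite /ysection /= inE => /Hc [h1 h2].
  by split; rewrite /= in_itv.
Qed.

End intensity_measure.

(** * Second moments of oscillations *)

Section moments.
Context {R : realType}.
Implicit Types (h : path_space R) (a b c T : R).

(* No measurability is required of the larger function. *)
Lemma ge0_integral_monotone d (T : measurableType d) (P : probability T R) (f g : T -> \bar R) :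
  (forall x, (0 <= f x)%E) -> (forall x, (f x <= g x)%E) ->
  (\int[P]_x f x <= \int[P]_x g x)%E.
Proof.
move=> f0 fg; rewrite !ge0_integralTE//; last first.
  by move=> x; exact: le_trans (fg x).
by apply: ereal_sup_le => _ [k /= kf <-]; exists k => //= x; exact: le_trans (fg x).
Qed.

Lemma oscillation_double a b T h : 0 <= a <= b -> b <= T ->
  oscillation a b h <= 2 * oscillation 0 T h.
Proof.
move=> ab bT; apply: oscillation_le => // s /andP[sa sb]; case/andP: ab => a0 ab.
have H u : 0 <= u <= T -> `|h u| <= oscillation 0 T h.
  by move=> uT; have := le_oscillation h (lexx 0) uT; rewrite path_at0 subr0.
apply: le_trans (ler_normB _ _) _; rewrite mulr2n mulrDl mul1r lerD// H//.
  by rewrite (le_trans a0)//= (le_trans sb).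
by rewrite a0 (le_trans ab).
Qed.

Definition max_oscillation T (N : nat) h : R :=
  \big[Num.max/0]_(k < N) oscillation (k%:R * (T / N%:R)) (k.+1%:R * (T / N%:R)) h.

Lemma measurable_bigmax d (X : measurableType d) (f : nat -> X -> R) N :
  (forall k, (k < N)%N -> measurable_fun setT (f k)) ->
  measurable_fun setT (fun x => \big[Num.max/0]_(k < N) f k x).
Proof.
elim: N f => [|N IH] f mf.
  by rewrite (_ : (fun x => _) = cst 0)//; apply/funext => x; rewrite big_ord0.
rewrite (_ : (fun x => _) = (fun x => Num.max (f 0%N x) (\big[Num.max/0]_(k < N) f k.+1 x))).
  by apply: measurable_maxr; [exact: mf|apply: (IH (fun k => f k.+1)) => k kN; exact: mf].
by apply/funext => x; rewrite big_ord_recl.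
Qed.

Let window T N k : 0 < T -> (k < N)%N ->
  0 <= k%:R * (T / N%:R) < k.+1%:R * (T / N%:R) /\ k.+1%:R * (T / N%:R) <= T.
Proof.
move=> T0 kN; have N0 : 0 < N%:R :> R by rewrite ltr0n; lia.
have TN : 0 < T / N%:R by rewrite divr_gt0.
split; first by rewrite mulr_ge0 ?ler0n ?(ltW TN)//= ltr_pM2r// ltr_nat.
by rewrite mulrCA ler_piMr ?(ltW T0)// ler_pdivrMr// mul1r ler_nat.
Qed.

Lemma measurable_max_oscillation T N : 0 < T -> measurable_fun setT (max_oscillation T N).
Proof.
move=> T0; apply: (measurable_bigmax
  (f := fun k => oscillation (k%:R * (T / N%:R)) (k.+1%:R * (T / N%:R)))) => k kN.
apply: measurable_oscillation.
by have [] := window T0 kN.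
Qed.

Lemma max_oscillation_ge0 T N h : 0 <= max_oscillation T N h.
Proof. by apply: bigmax_ge_id. Qed.

Lemma max_oscillation_double T N h : 0 < T ->
  max_oscillation T N h <= 2 * oscillation 0 T h.
Proof.
move=> T0; apply: bigmax_le => [|k _].
  by rewrite mulr_ge0// oscillation_ge0// lexx ltW.
have [/andP[k0 /ltW kk] kT] := window T0 (ltn_ord k).
by apply: oscillation_double => //; rewrite k0.
Qed.

Lemma max_oscillation_cvg T h : 0 < T -> max_oscillation T n h @[n --> \oo] --> 0.
Proof.
move=> T0; apply/cvgrPdist_le => e e0.
have [dl dl0 Hdl] := path_unif_continuous h T e0.
near=> n.
have n0 : 0 < n%:R :> R by rewrite ltr0n; near: n; exists 1%N.
rewrite sub0r normrN ger0_norm ?max_oscillation_ge0//.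
apply: bigmax_le => [|k _]; first exact: ltW.
have [/andP[k0 kk] kT] := window T0 (ltn_ord k).
apply: oscillation_le; first by rewrite k0 ltW.
move=> s /andP[s1 s2]; apply/ltW/Hdl.
- by rewrite (le_trans k0)//= (le_trans s2).
- by rewrite k0 (le_trans _ kT)// ltW.
rewrite ger0_norm ?subr_ge0//; apply: (@le_lt_trans _ _ (T / n%:R)).
  by move: s2; rewrite -natr1 mulrDl mul1r lerBlDl.
rewrite ltr_pdivrMr// mulrC -ltr_pdivrMr//.
apply: lt_le_trans (truncnS_gt _) _; rewrite ler_nat.
by near: n; exists (Num.truncn (T / dl)).+1.
Unshelve. all: by end_near. Qed.

Lemma integral_dominated_small d (X : measurableType d) (P : probability X R)
    (f : nat -> X -> R) (g : X -> R) (e : R) :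
  (forall n, measurable_fun setT (f n)) -> (forall n x, 0 <= f n x <= g x) ->
  P.-integrable setT (fun x => (g x)%:E) -> (forall x, f n x @[n --> \oo] --> 0) -> 0 < e ->
  exists N : nat, forall n, (N <= n)%N -> (\int[P]_x (f n x)%:E <= e%:E)%E.
Proof.
move=> mf fg ig f0 e0.
have [||||_ _] := @dominated_convergence _ _ _ P setT measurableT
  (fun n x => (f n x)%:E) (cst 0%E) (fun x => (g x)%:E) _ _ _ ig _.
- by move=> n; exact/measurable_EFinP.
- exact: measurable_cst.
- by apply: aeW => x _; apply: cvg_EFin; [exact: nearW|exact: f0].
- apply: aeW => x n _; have /andP[h1 h2] := fg n x.
  by rewrite gee0_abs ?lee_fin.
rewrite integral0 => /fine_cvgP[fin /cvgrPdist_le /(_ e e0) H].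
have [N _ HN] : \forall n \near \oo, (\int[P]_x (f n x)%:E <= e%:E)%E.
  near=> n; rewrite -(@fineK _ (\int[P]_x _)%E); last by near: n.
  rewrite lee_fin; have : `|0 - fine (\int[P]_x (f n x)%:E)%E| <= e by near: n.
  by rewrite sub0r normrN; apply: le_trans; exact: ler_norm.
by exists N => n; exact: HN.
Unshelve. all: by end_near. Qed.

Section second_moment.
Context (mu : probability (path_space R) R).

Lemma path_second_moment d (Omega : measurableType d) (P : probability Omega R)
    (h : {mfun Omega >-> path_space R}) T :
  (forall A : set (path_space R), measurable A -> distribution P h A = mu A) ->
  0 < T ->
  ('E_P[fun w => (sup [set sqnorm (h w s) | s in `[0%R, T]])%R] < +oo)%E ->
  (\int[mu]_k (oscillation 0 T k ^+ 2)%:E < +oo)%E.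
Proof.
move=> h_law T0; rewrite unlock; apply: le_lt_trans.
have mo : measurable_fun setT (fun k : path_space R => (oscillation 0 T k ^+ 2)%:E).
  apply/measurable_EFinP; apply: measurable_funX.
  by apply: measurable_oscillation; rewrite lexx.
(* The integral is carried to [Omega], where the squared oscillation, taken in the max norm, is
   compared pointwise with the supremum of [sqnorm]. *)
rewrite -(@eq_measure_integral _ _ _ _ mu (distribution P h)); last first.
  by move=> A mA _; exact: h_law.
rewrite ge0_integral_distribution//; last by move=> y; rewrite lee_fin sqr_ge0.
apply: ge0_integral_monotone => w /=; first by rewrite lee_fin sqr_ge0.
rewrite lee_fin; set A := [set sqnorm (h w s) | s in _].
have sA : has_sup A.
  split; first by exists (sqnorm (h w 0)), 0 => //=; rewrite in_itv /= lexx ltW.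
  have [B B0 HB] := path_bounded (h w) T; exists (B ^+ 2 + B ^+ 2) => _ [s sT <-].
  move: sT; rewrite /= in_itv /= => /HB; rewrite prod_norm_lt => /andP[h1 h2].
  have H (x : R) : `|x| < B -> x ^+ 2 <= B ^+ 2.
    by move=> xB; rewrite -real_normK ?num_real// ler_sqr ?nnegrE ?(ltW B0)// ltW.
  by apply: lerD; exact: H.
have A0 : 0 <= sup A.
  apply: le_trans (_ : sqnorm (h w 0) <= _); first by rewrite addr_ge0 ?sqr_ge0.
  by apply: sup_upper_bound => //; exists 0 => //=; rewrite in_itv /= lexx ltW.
rewrite -[leRHS]sqr_sqrtr// ler_sqr ?nnegrE ?sqrtr_ge0 ?oscillation_ge0 ?lexx ?(ltW T0)//.
apply: oscillation_le => [|s sT]; first by rewrite lexx ltW.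
rewrite path_at0 subr0.
have sAs : sqnorm (h w s) <= sup A.
  by apply: sup_upper_bound => //; exists s => //=; rewrite in_itv.
rewrite prod_norm_le -!sqrtr_sqr !ler_wsqrtr//; apply: le_trans sAs.
- by rewrite lerDr sqr_ge0.
- by rewrite lerDl sqr_ge0.
Qed.

Hypothesis moment : forall T, 0 < T -> (\int[mu]_k (oscillation 0 T k ^+ 2)%:E < +oo)%E.

Let integrable_osc T : 0 < T ->
  mu.-integrable setT (fun h => ((2 * oscillation 0 T h) ^+ 2)%:E).
Proof.
move=> T0; have mo : measurable_fun setT (fun k : path_space R => oscillation 0 T k).
  by apply: measurable_oscillation; rewrite lexx.
apply/integrableP; split.
  by apply/measurable_EFinP/measurable_funX; exact: measurable_funM.
rewrite (_ : (fun x => _) = (fun h => 4%:E * (oscillation 0 T h ^+ 2)%:E)%E).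
  rewrite ge0_integralZl//.
  - by rewrite lte_mul_pinfty// moment.
  - by apply/measurable_EFinP; exact: measurable_funX.
  - by move=> h _; rewrite lee_fin sqr_ge0.
apply/funext => h; rewrite gee0_abs ?lee_fin ?sqr_ge0// -EFinM; congr (_%:E).
by rewrite exprMn -natrX.
Qed.

(** One [N] serves all windows because the largest of their oscillations dominates each; it tends to
    0 by uniform continuity and stays below twice the oscillation over [[0, T]], so dominated
    convergence applies. *)
Lemma small_windows T (dl : R) : 0 < T -> 0 < dl -> exists2 N : nat, (0 < N)%N &
  forall k, (k < N)%N -> (\int[mu]_h
    (oscillation (k%:R * (T / N%:R)) (k.+1%:R * (T / N%:R)) h ^+ 2)%:E <= dl%:E)%E.
Proof.
move=> T0 dl0.
have [|||N HN] := @integral_dominated_small _ _ mu (fun N h => max_oscillation T N h ^+ 2)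
  (fun h => (2 * oscillation 0 T h) ^+ 2) dl _ _ (integrable_osc T0) _ dl0.
- by move=> N; apply: measurable_funX; exact: measurable_max_oscillation.
- move=> N h; rewrite sqr_ge0 ler_sqr ?nnegrE ?max_oscillation_ge0 ?max_oscillation_double//.
  by rewrite mulr_ge0// oscillation_ge0// lexx ltW.
- move=> h; rewrite -[X in _ --> X](mulr0 0).
  under eq_fun do rewrite expr2.
  by apply: cvgM; exact: max_oscillation_cvg.
exists N.+1 => // k kN; apply: le_trans (HN _ (leqnSn N)).
have [/andP[k0 kk] kT] := window T0 kN.
apply: ge0_integral_monotone => h; rewrite lee_fin ?sqr_ge0//.
rewrite ler_sqr ?nnegrE ?max_oscillation_ge0 ?oscillation_ge0 ?k0 ?(ltW kk)//.
by rewrite /max_oscillation (le_bigmax _ _ (Ordinal kN)).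
Qed.

Lemma tail_second_moment (rho : path_space R -> R) (e : R) :
  measurable_fun setT rho -> (forall h, 0 <= rho h) ->
  (\int[mu]_h (rho h ^+ 2)%:E < +oo)%E -> 0 < e ->
  exists N : nat, forall c, N%:R <= c ->
   (\int[mu]_h ((if c <= rho h then rho h else 0)%R ^+ 2)%:E <= e%:E)%E.
Proof.
move=> mrho rho0 irho e0.
pose f (n : nat) h := (if n%:R <= rho h then rho h else 0) ^+ 2.
have [||||N HN] := @integral_dominated_small _ _ mu f (fun h => rho h ^+ 2) e _ _ _ _ e0.
- move=> n; apply: measurable_funX; apply: measurable_fun_ifT => //.
  exact: measurable_fun_ler.
- by move=> n h; rewrite /f; case: ifP => _; rewrite ?expr0n /= ?sqr_ge0 ?lexx.
- apply/integrableP; split; first by apply/measurable_EFinP; exact: measurable_funX.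
  by under eq_integral do rewrite gee0_abs ?lee_fin ?sqr_ge0//.
- move=> h; apply/cvgrPdist_le => d d0; near=> n.
  suff -> : f n h = 0 by rewrite subrr normr0 ltW.
  rewrite /f ifF ?expr0n//; apply/negbTE; rewrite -ltNge.
  apply: lt_le_trans (truncnS_gt _) _; rewrite ler_nat.
  by near: n; exists (Num.truncn (rho h)).+1.
exists N => c Nc; apply: le_trans (HN N (leqnn _)).
apply: ge0_integral_monotone => h; rewrite lee_fin ?sqr_ge0//.
rewrite /f; case: ifP => ch; last by rewrite expr0n sqr_ge0.
by rewrite (le_trans Nc ch).
Unshelve. all: by end_near. Qed.

End second_moment.
End moments.

(** * Intensity of sets of sites *)

Section site_intensity.
Context {R : realType}.
Variables (l a b : R).
Hypotheses (l0 : 0 < l) (ab : 0 <= a < b).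
Implicit Types (p : mpoint R) (h : path_space R) (z : int * int) (u : site).

Let a0 : 0 <= a. Proof. by case/andP: ab. Qed.

Lemma measurable_site_of (U : set site) : measurable (site_of l a b @^-1` U).
Proof.
have m1 : measurable_fun setT (fun p : mpoint R => gpos p a).
  exact: measurable_gpos a0 _.
have [m11 m12] := (measurable_fun_pairP (fun p : mpoint R => gpos p a)).1 m1.
have mo : measurable_fun setT (fun p : mpoint R => oscillation a b p.2).
  exact: (measurableT_comp (measurable_oscillation ab) measurable_snd).
have mle (f g : mpoint R -> R) : measurable_fun setT f -> measurable_fun setT g ->
    measurable [set p | f p <= g p].
  move=> mf mg; rewrite (_ : mkset _ = ~` [set p | g p < f p]).
    by apply: measurableC; exact: measurable_set_ltr.
  by apply/seteqP; split => p /=; rewrite leNgt => /negP.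
have mdiv (f : mpoint R -> R) : measurable_fun setT f -> measurable_fun setT (fun p => f p / l).
  by move=> mf; exact: measurable_funM.
have mfloor (f : mpoint R -> R) (n : int) : measurable_fun setT f ->
    measurable [set p | Num.floor (f p / l) = n].
  move=> mf; rewrite (_ : mkset _ = [set p | n%:~R <= f p / l] `&`
      [set p | f p / l < (n + 1)%:~R]).
    apply: measurableI; [apply: mle => //|apply: measurable_set_ltr => //]; exact: mdiv.
  apply/seteqP; split => p /=; first by move/eqP; rewrite floor_eq => /andP.
  by move=> /andP; rewrite -floor_eq => /eqP.
have msite u : measurable [set p | site_of l a b p = u].
  case: u => -[u1 u2] n; rewrite (_ : mkset _ =
    [set p | Num.floor ((gpos p a).1 / l) = u1] `&` [set p | Num.floor ((gpos p a).2 / l) = u2] `&`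
    ([set p | n%:R <= oscillation a b p.2 / l] `&` [set p | oscillation a b p.2 / l < n.+1%:R])).
    apply: measurableI; first by apply: measurableI; exact: mfloor.
    apply: measurableI; [apply: mle => //|apply: measurable_set_ltr => //]; exact: mdiv.
  have H p : (Num.truncn (oscillation a b p.2 / l) == n) =
      (n%:R <= oscillation a b p.2 / l < n.+1%:R).
    by rewrite truncn_eq// divr_ge0 ?(ltW l0)// oscillation_ge0// a0 ltW; case/andP: ab.
  apply/seteqP; split => p /=; rewrite /site_of.
    move=> [-> -> /eqP]; rewrite H => /andP[? ?]; split => //.
  by move=> [[-> ->]] /andP; rewrite -H => /eqP ->.
rewrite (_ : _ @^-1` _ = \bigcup_(u : site) [set p | site_of l a b p = u /\ U u]); last first.
  by apply/seteqP; split => p /=; [move=> Up; exists (site_of l a b p)|move=> [u _ [-> ]]].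
apply: countable_bigcupT_measurable => [|u]; first exact: countableP.
have [Uu|Uu] := pselect (U u).
  by rewrite (_ : mkset _ = [set p | site_of l a b p = u])//; apply/seteqP; split => p // [].
by rewrite (_ : mkset _ = set0)//; apply/seteqP; split => p // [].
Qed.

(** For a given path, the starting points form part of a square of side [(2 n + 1) l], translated by
    the displacement of the path at time [a]. *)
Lemma near_cell_box p z n : near_cell (site_of l a b p).1 z n ->
  let c1 := l * (z.1%:~R - n%:R) - (p.2 a).1 in
  let c2 := l * (z.2%:~R - n%:R) - (p.2 a).2 in
  c1 <= p.1.1 <= c1 + (2 * n).+1%:R * l /\ c2 <= p.1.2 <= c2 + (2 * n).+1%:R * l.
Proof.
move=> H; have E (x y : R) (zz : int) : (Num.floor ((x + y) / l) <= zz + n%:Z)%R ->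
    (zz <= Num.floor ((x + y) / l) + n%:Z)%R ->
    l * (zz%:~R - n%:R) - y <= x <= l * (zz%:~R - n%:R) - y + (2 * n).+1%:R * l.
  have := floor_le ((x + y) / l); have := floorD1_gt ((x + y) / l).
  move: (Num.floor _) => f; rewrite ltr_pdivrMr// ler_pdivlMr// rmorphD /= => h1 h2.
  rewrite -(ler_int R) -[(zz <= _)%R](ler_int R) !rmorphD /= => h3 h4.
  have h5 : (zz%:~R - n%:R) * l <= f%:~R * l by rewrite ler_pM2r//; lra.
  have h6 : (f%:~R + 1) * l <= (zz%:~R + n%:R + 1) * l by rewrite ler_pM2r//; lra.
  have -> : (2 * n).+1%:R = 2 * n%:R + 1 :> R by rewrite -natr1 natrM.
  rewrite mulrC; lra.
case/and4P: H => /= h1 h2 h3 h4; split; exact: E.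
Qed.

Section bounds.
Variable mu : probability (path_space R) R.

Definition tail_moment c : \bar R := (\int[mu]_h
  ((if c <= oscillation a b h then oscillation a b h else 0)%R ^+ 2)%:E)%E.

Let osc0 h : 0 <= oscillation a b h.
Proof. by rewrite oscillation_ge0// a0 ltW; case/andP: ab. Qed.

Lemma intensity_near_cell z n :
  (intensity mu (site_of l a b @^-1` [set u | near_cell u.1 z n]) <=
   (((2 * n).+1%:R * l) ^+ 2)%:E)%E.
Proof.
rewrite -[leRHS]mule1 -(@probability_setT _ _ _ mu) -integral_cst//.
apply: intensity_le => //; first exact: measurable_site_of.
  by move=> h; rewrite mulr_ge0// ltW.
move=> h; exists (l * (z.1%:~R - n%:R) - (h a).1, l * (z.2%:~R - n%:R) - (h a).2) => y.
by move=> /near_cell_box.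
Qed.

(** The square may be sized by the path: its area is at most [K ^ 2] times the squared oscillation,
    and integration over paths produces the second moment, restricted to large oscillations. *)
Lemma intensity_sites_le (U : set site) z (n : path_space R -> nat) (K c : R) : 0 <= K ->
  (forall p, U (site_of l a b p) -> [/\ near_cell (site_of l a b p).1 z (n p.2),
    c <= oscillation a b p.2 & (2 * n p.2).+1%:R * l <= K * oscillation a b p.2]) ->
  (intensity mu (site_of l a b @^-1` U) <= (K ^+ 2)%:E * tail_moment c)%E.
Proof.
move=> K0 HU; pose f h := if c <= oscillation a b h then oscillation a b h else 0.
have mo : measurable_fun setT (oscillation a b) by exact: measurable_oscillation.
have mf : measurable_fun setT f.
  by apply: measurable_fun_ifT => //; exact: measurable_fun_ler.
have f0 h : 0 <= f h by rewrite /f; case: ifP.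
rewrite /tail_moment -ge0_integralZl//; last 3 first.
- by apply/measurable_EFinP; exact: measurable_funX.
- by move=> h _; rewrite lee_fin sqr_ge0.
- by rewrite lee_fin sqr_ge0.
under eq_integral do rewrite -EFinM -exprMn.
apply: intensity_le; first exact: measurable_site_of.
- by apply: measurable_funM.
- by move=> h; rewrite mulr_ge0//; case: ifP.
move=> h; exists (l * (z.1%:~R - (n h)%:R) - (h a).1, l * (z.2%:~R - (n h)%:R) - (h a).2) => y.
move=> /HU[/near_cell_box /= [/andP[h1 h2] /andP[h3 h4]] ch nK].
rewrite /f ch h1 h3 /=; split.
  by apply: le_trans h2 _; rewrite lerD2l.
by apply: le_trans h4 _; rewrite lerD2l.
Qed.

Let level_le p : (site_of l a b p).2%:R * l <= oscillation a b p.2.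
Proof. by rewrite -ler_pdivlMr// truncn_le divr_ge0// ltW. Qed.

Definition large_site z al : set site :=
  [set u | near_cell u.1 z (60 * al) /\ ~ (2 * u.2 + 2 <= al)%N].

(** From [2 n + 2 > al >= 4] the level [n] satisfies [al <= 4 n], so the oscillation is at least
    [al l / 4]; the side [(120 al + 1) l] is at most [121 al l], that is 484 times the
    oscillation. *)
Lemma intensity_large_site z al : (4 <= al)%N ->
  (intensity mu (site_of l a b @^-1` large_site z al) <=
   (484 ^+ 2)%R%:E * tail_moment (al%:R * l / 4)%R)%E.
Proof.
move=> al4; apply: (@intensity_sites_le _ z (fun=> (60 * al)%N)); first exact: ler0n.
move=> p [pz /negP lp].
have := level_le p; move: (site_of l a b p).2 lp => n lp nl.
have h : al%:R * l <= 4 * (n%:R * l).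
  by rewrite mulrA -natrM ler_pM2r// ler_nat; lia.
split => //; first by lra.
have -> : (2 * (60 * al)).+1%:R = 120 * al%:R + 1 :> R by rewrite -natr1 !natrM; lra.
have h1 : 1 * l <= al%:R * l by rewrite ler_pM2r// ler1n; lia.
lra.
Qed.

Definition far_large_site al : set site :=
  [set u | exists n, [/\ (al <= n)%N, near_cell u.1 (0, 0) n & ~ (8 * u.2 + 8 <= n)%N]].

(** Such a site of level [m] lies within [8 m + 7] cells of the origin, in a box of side
    [(16 m + 15) l <= 31 m l]. The box grows with the grain, so all distances are treated at
    once. *)
Lemma intensity_far_large_site al : (16 <= al)%N ->
  (intensity mu (site_of l a b @^-1` far_large_site al) <=
   (31 ^+ 2)%R%:E * tail_moment (al%:R * l / 16)%R)%E.
Proof.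
move=> al16; apply: (@intensity_sites_le _ (0, 0)
  (fun h => (8 * Num.truncn (oscillation a b h / l) + 7)%N)); first exact: ler0n.
move=> p [n [aln pz /negP lp]].
have -> : Num.truncn (oscillation a b p.2 / l) = (site_of l a b p).2 by [].
have := level_le p; move: pz lp; move: (site_of l a b p) => [c m] /= pz lp nl.
have h : al%:R * l <= 16 * (m%:R * l).
  by rewrite mulrA -natrM ler_pM2r// ler_nat; lia.
split; [by apply: near_cell_le pz; lia|by lra|].
have -> : (2 * (8 * m + 7)).+1%:R = 16 * m%:R + 15 :> R.
  by rewrite -natr1 natrM natrD natrM; lra.
have h1 : 1 * l <= m%:R * l by rewrite ler_pM2r// ler1n; lia.
lra.
Qed.

End bounds.

End site_intensity.

(** * Poisson counts *)

Section poisson_counts.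
Context {R : realType} {d dO : measure_display} {M : measurableType d} {D : set M}.
Context {Omega : measurableType dO} (P : probability Omega R).
Context (xi : {mfun Omega >-> mconf R D}) (Lambda : set ((R * R) * M) -> \bar R).
Hypothesis poisson : poisson_point_process P xi Lambda.
Hypothesis Lambda_ge0 : forall A, (0 <= Lambda A)%E.
Implicit Types (A : set ((R * R) * M)).

Lemma measurable_count_event A (B : set (\bar R)) : measurable A -> measurable B ->
  measurable [set w | B (mcount A (xi w))].
Proof.
move=> mA mB; rewrite -[X in measurable X]setTI.
exact: (measurableT_comp (measurable_mcount mA) (measurable_funPT xi)).
Qed.

Definition hit A : set Omega := [set w | (0 < mcount A (xi w))%E].

Lemma hitP A w : hit A w <-> exists2 p, mconf_set (xi w) p & A p.
Proof.
split; first by move=> /counting_gt0[p [Sp Ap]]; exists p.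
by move=> [p Sp Ap]; apply/counting_gt0; exists p.
Qed.

Lemma measurable_hit A : measurable A -> measurable (hit A).
Proof.
move=> mA; apply: (measurable_count_event (B := [set x | (0 < x)%E])) => //.
by rewrite -[X in measurable X]setTI; exact: emeasurable_fun_o_infty.
Qed.

(** This is [1 - exp (- x) <= x] at [x = Lambda A]. *)
Lemma poisson_hit_le A : measurable A -> (P (hit A) <= Lambda A)%E.
Proof.
move=> mA; have [H _] := poisson; have [H1 H2] := H A mA.
have [LA|] := ltP (Lambda A) +oo%E; last first.
  by rewrite leye_eq => /eqP ->; rewrite leey.
have {H}H0 := H1 LA 0%N.
have hitC : hit A = ~` [set w | mcount A (xi w) = 0%:R%:E].
  apply/seteqP; split => w /=; rewrite /hit /=.
    by move=> + E; rewrite E ltxx.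
  by move=> /eqP E; rewrite lt_neqAle eq_sym E measure_ge0.
have m0 : measurable [set w | mcount A (xi w) = 0%:R%:E].
  exact: (measurable_count_event (B := [set 0%:R%:E])).
rewrite hitC probability_setC// H0 /poisson_prob.
have Lf : Lambda A \is a fin_num by rewrite ge0_fin_numE.
case: ifPn => r0; last by rewrite diracE mem_set//= subee.
rewrite esum_set1 ?lee_fin ?poisson_pmf_ge0// /poisson_pmf r0 expr0 fact0 mul1r invr1 mul1r.
rewrite -[leRHS]fineK// -EFinB lee_fin lerBlDr addrC -lerBlDr.
exact: expR_ge1Dx.
Qed.

(** The probabilities of the finite counts form a Poisson law; they sum to 1 and leave no mass to an
    infinite count. *)
Lemma poisson_count_finite A : measurable A -> (Lambda A < +oo)%E ->
  P.-negligible [set w | mcount A (xi w) = +oo%E].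
Proof.
move=> mA LA; have [H _] := poisson; have [H1 _] := H A mA.
have {}H1 := H1 LA.
pose N k := [set w | mcount A (xi w) = k%:R%:E].
have mN k : measurable (N k).
  exact: (measurable_count_event (B := [set k%:R%:E])).
have tN : trivIset setT N.
  apply/trivIsetP => i j _ _ ij; apply/seteqP; split => // w [].
  by rewrite /N /= => -> [] /eqP; rewrite eqr_nat (negbTE ij).
have PN : P (\bigcup_k N k) = 1%E.
  have <- : poisson_prob (fine (Lambda A)) 0 (\bigcup_k [set k]) = 1%E.
    rewrite -(@probability_setT _ _ _ (poisson_prob (fine (Lambda A)) 0)).
    by congr poisson_prob; apply/seteqP; split => // k _; exists k.
  rewrite !measure_bigcup//=; last first.
    by apply/trivIsetP => i j _ _ /eqP ij; apply/seteqP; split => // w [] /= ->.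
  by apply: eq_eseriesr => k _; exact: H1.
rewrite (_ : mkset _ = ~` \bigcup_k N k); last first.
  apply/seteqP; split => w /=; first by move=> E [k _]; rewrite /N /= E.
  move=> H'; rewrite /mcount /counting in H' *; case: asboolP => // fA.
  exfalso; apply: H'; eexists => //; rewrite /N /= /mcount /counting asboolT//.
have mU : measurable (\bigcup_k N k) by exact: bigcupT_measurable.
exists (~` \bigcup_k N k); split => //; first exact: measurableC.
by rewrite probability_setC// PN subee.
Qed.

End poisson_counts.

(** * Independence of events that depend on disjoint families of cells *)

Section independence.
Context {R : realType} {d dO : measure_display} {M : measurableType d} {D : set M}.
Context {Omega : measurableType dO} (P : probability Omega R).
Context (xi : {mfun Omega >-> mconf R D}) (Lambda : set ((R * R) * M) -> \bar R).
Hypothesis poisson : poisson_point_process P xi Lambda.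
Context (I : eqType) (cell : I -> set ((R * R) * M)).
Hypotheses (mcell : forall i, measurable (cell i)).
Hypotheses (disj : forall i j, i != j -> cell i `&` cell j = set0).
Implicit Types (s : seq (I * bool)) (r : seq I) (f : (I -> bool) -> Prop) (u : I) (b : bool).

Definition bit (w : Omega) u : bool := `[< hit xi (cell u) w >].

Definition bit_event u b : set Omega := [set w | bit w u = b].

Definition cylinder s : set Omega := [set w | forall c, c \in s -> bit w c.1 = c.2].

Definition fun_event f : set Omega := [set w | f (bit w)].

Definition depends_on r f := forall g g' : I -> bool,
  (forall i, i \in r -> g i = g' i) -> f g -> f g'.

Definition fix_bit u b f : (I -> bool) -> Prop :=
  fun g => f (fun v => if v == u then b else g v).

Lemma measurable_bit_event u b : measurable (bit_event u b).
Proof.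
have mh := measurable_hit xi (mcell u).
case: b; rewrite /bit_event /bit.
  by rewrite (_ : mkset _ = hit xi (cell u))//; apply/seteqP; split => w /asboolP.
rewrite (_ : mkset _ = ~` hit xi (cell u)); first exact: measurableC.
apply/seteqP; split => w /=; first by move/negbT/asboolPn.
by move=> H; apply/negbTE/asboolPn.
Qed.

Lemma cylinder_cons u b s : cylinder ((u, b) :: s) = bit_event u b `&` cylinder s.
Proof.
apply/seteqP; split => w /=.
  move=> H; split; first by apply: (H (u, b)); rewrite mem_head.
  by move=> c cs; apply: H; rewrite in_cons cs orbT.
by move=> [H1 H2] c; rewrite in_cons => /orP[/eqP ->//|/H2].
Qed.

Lemma measurable_cylinder s : measurable (cylinder s).
Proof.
elim: s => [|[u b] s IH]; last first.
  by rewrite cylinder_cons; apply: measurableI => //; exact: measurable_bit_event.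
by rewrite (_ : cylinder [::] = setT)//; apply/seteqP; split.
Qed.

Lemma poisson_cylinder s : uniq (map fst s) ->
  P (cylinder s) = (\prod_(c <- s) P (bit_event c.1 c.2))%E.
Proof.
move=> us; have [_ ind] := poisson.
pose B b : set (\bar R) := if b then [set x | (0 < x)%E] else ~` [set x | (0 < x)%E].
have mB b : measurable (B b).
  have mpos : measurable [set x : \bar R | (0 < x)%E].
    by rewrite -[X in measurable X]setTI; exact: emeasurable_fun_o_infty.
  by case: b => //; exact: measurableC.
have bB u b w : bit w u = b <-> B b (mcount (cell u) (xi w)).
  rewrite /bit /B; case: b => /=; first by split => /asboolP.
  by split => [/negbT/asboolPn//|H]; apply/negbTE/asboolPn.
have := ind (size s) (fun i => cell (tnth (in_tuple s) i).1)
  (fun i => B (tnth (in_tuple s) i).2) (fun i => mcell _) _ (fun i => mB _).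
rewrite (_ : mkset _ = cylinder s).
  move=> ->; last first.
    apply/trivIsetP => i j _ _ ij; apply: disj; apply: contra ij => /eqP.
    have tE (k : 'I_(size s)) : (tnth (in_tuple s) k).1 = nth (tnth (in_tuple s) i).1 (map fst s) k.
      by rewrite (nth_map (tnth (in_tuple s) i))//; congr fst; exact: tnth_nth.
    rewrite (tE i) (tE j) => /eqP; rewrite nth_uniq ?size_map//.
  rewrite [RHS]big_tnth; apply: eq_bigr => i _; congr (P _); apply/seteqP; split => w /=.
    by move/bB.
  by move/bB.
apply/seteqP; split => w /= H.
  move=> c /(tnthP (in_tuple s))[i ->]; exact/bB.
by move=> i; apply/bB; apply: H; exact: mem_tnth.
Qed.

Lemma fix_bit_depends u b r f : depends_on (u :: r) f -> depends_on r (fix_bit u b f).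
Proof.
move=> df g g' gg; apply: df => i; rewrite in_cons.
by case: eqP => //= _; exact: gg.
Qed.

Lemma fun_event_fix u b f :
  fun_event f `&` bit_event u b = bit_event u b `&` fun_event (fix_bit u b f).
Proof.
have E w : bit w u = b -> (fun v => if v == u then b else bit w v) = bit w.
  by move=> wb; apply/funext => v; case: eqP => // ->.
apply/seteqP; split => w [H1 H2]; split => //.
  by rewrite /fun_event /fix_bit /= E.
by move: H2; rewrite /fun_event /fix_bit /= E.
Qed.

Lemma fun_event_nil f : depends_on [::] f -> fun_event f = setT \/ fun_event f = set0.
Proof.
move=> df; have [ff|nf] := pselect (f xpred0).
  by left; apply/seteqP; split => // w _; exact: (df xpred0).
right; apply/seteqP; split => // w fw; apply: nf.
exact: (df (bit w)).
Qed.

Lemma measurable_fun_event r f : depends_on r f -> measurable (fun_event f).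
Proof.
elim: r f => [|u r IH] f df.
  by have [->|->] := fun_event_nil df.
have mb b : measurable (fun_event f `&` bit_event u b).
  rewrite fun_event_fix; apply: measurableI; first exact: measurable_bit_event.
  by apply: IH; exact: fix_bit_depends df.
rewrite (_ : fun_event f = (fun_event f `&` bit_event u true) `|` (fun_event f `&` bit_event u false)).
  exact: measurableU.
rewrite -setIUr; apply/seteqP; split => w /=; last by case.
by move=> fw; split => //; rewrite /bit_event /=; case: (bit w u); [left|right].
Qed.

Lemma probability_split_bit A u : measurable A ->
  P A = (P (A `&` bit_event u true) + P (A `&` bit_event u false))%E.
Proof.
move=> mA; rewrite -measureU//; [|by apply: measurableI => //; exact: measurable_bit_event..|].
- congr (P _); rewrite -setIUr; apply/seteqP; split => w /=; last by case.
  by move=> fw; split => //; rewrite /bit_event /=; case: (bit w u); [left|right].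
- apply/seteqP; split => // w [[_]]; rewrite /bit_event /= => H1 [_ /=].
  by rewrite H1.
Qed.

(** Splitting on the bit of the first cell of [r] moves this cell from the function to the cylinder;
    for cylinders the product formula is the Poisson hypothesis, and the two halves are then
    reassembled. *)
Lemma cylinder_fun_event s r f : uniq (map fst s ++ r) -> depends_on r f ->
  P (cylinder s `&` fun_event f) = (P (cylinder s) * P (fun_event f))%E.
Proof.
elim: r s f => [|u r IH] s f us df.
  by have [->|->] := fun_event_nil df;
    rewrite ?setIT ?probability_setT ?mule1 ?setI0 ?measure0 ?mule0.
have step s' b : uniq (map fst s' ++ u :: r) -> P ((cylinder s' `&` fun_event f) `&` bit_event u b) =
    (P (cylinder s') * (P (bit_event u b) * P (fun_event (fix_bit u b f))))%E.
  move=> us'; rewrite -setIA fun_event_fix setIA [cylinder s' `&` _]setIC -cylinder_cons.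
  have us1 : uniq (map fst ((u, b) :: s') ++ r).
    by move: us'; rewrite -cat1s uniq_catCA.
  rewrite IH//; last exact: fix_bit_depends.
  have us2 : uniq (map fst ((u, b) :: s')) by move: us1; rewrite cat_uniq => /andP[].
  have us3 : uniq (map fst s') by case/andP: us2.
  by rewrite poisson_cylinder// big_cons -poisson_cylinder// muleAC muleC.
rewrite (probability_split_bit u); last first.
  by apply: measurableI; [exact: measurable_cylinder|exact: measurable_fun_event df].
rewrite !step// -ge0_muleDr//; try exact: mule_ge0.
congr (_ * _)%E; have c0 : cylinder [::] = setT by apply/seteqP; split.
have ur : uniq (map fst ([::] : seq (I * bool)) ++ u :: r) by move: us; rewrite cat_uniq => /and3P[].
have := step [::] true ur; have := step [::] false ur.
rewrite c0 !setTI probability_setT !mul1e => <- <-.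
by rewrite -probability_split_bit//; exact: measurable_fun_event df.
Qed.

Lemma independent_fun_events r1 r2 f1 f2 : uniq (r1 ++ r2) ->
  depends_on r1 f1 -> depends_on r2 f2 ->
  P (fun_event f1 `&` fun_event f2) = (P (fun_event f1) * P (fun_event f2))%E.
Proof.
move=> ur d1 d2; have m2 := measurable_fun_event d2.
(* The cylinder [s] receives the bits of [r1] one by one during the induction. *)
suff H s : uniq (map fst s ++ r1 ++ r2) -> P (cylinder s `&` fun_event f1 `&` fun_event f2) =
    (P (cylinder s `&` fun_event f1) * P (fun_event f2))%E.
  have c0 : cylinder [::] = setT by apply/seteqP; split.
  by have := H [::] ur; rewrite c0 setTI.
elim: r1 s f1 d1 {ur} => [|u r IH] s f d1 us.
  have [->|->] := fun_event_nil d1; last by rewrite setI0 set0I measure0 mul0e.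
  by rewrite setIT; exact: cylinder_fun_event us d2.
have mf := measurable_fun_event d1; have mc := measurable_cylinder s.
have us' b : uniq (map fst ((u, b) :: s) ++ r ++ r2).
  by move: us; rewrite /= -cat1s uniq_catCA.
have E b : P (cylinder s `&` fun_event f `&` fun_event f2 `&` bit_event u b) =
    (P (cylinder s `&` fun_event f `&` bit_event u b) * P (fun_event f2))%E.
  rewrite setIAC -[cylinder s `&` fun_event f `&` bit_event u b]setIA fun_event_fix.
  rewrite setIA [cylinder s `&` bit_event u b]setIC -cylinder_cons.
  by apply: IH => //; exact: fix_bit_depends d1.
rewrite (probability_split_bit u) ?[X in _ = (X * _)%E](probability_split_bit u).
- by rewrite !E -ge0_muleDl.
- exact: measurableI.
- by apply: measurableI => //; exact: measurableI.
Qed.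

End independence.

(** * The recursion on crossing probabilities *)

Section crossing_probability.
Context {R : realType}.
Variables (l a b : R).
Hypotheses (l0 : 0 < l) (ab : 0 <= a < b).
Variable mu : probability (path_space R) R.
Context {dO : measure_display} {Omega : measurableType dO} (P : probability Omega R).
Context (xi : {mfun Omega >-> conf R}).
Hypothesis poisson : poisson_point_process P xi (intensity mu).
Implicit Types (z : int * int) (u : site) (w : Omega) (al : nat).

Let occ w := occupied l a b (xi w).

Let cell u : set (mpoint R) := site_of l a b @^-1` [set u].

Let mcell u : measurable (cell u).
Proof. exact: measurable_site_of. Qed.

Let disj u v : u != v -> cell u `&` cell v = set0.
Proof.
by move=> /eqP uv; apply/seteqP; split => // p [/= pu pv]; apply: uv; rewrite -pu -pv.
Qed.

Let hit_site (U : set site) w : hit xi (site_of l a b @^-1` U) w <-> exists2 u, occ w u & U u.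
Proof.
split; first by move=> /hitP[p Sp Up]; exists (site_of l a b p) => //; exists p.
by move=> [_ [p Sp <-] Up]; apply/hitP; exists p.
Qed.

Let bitE w : (fun u => is_true (bit xi cell w u)) = occ w.
Proof.
apply/funext => u; apply/propext; split.
  by move=> /asboolP/hit_site[v ov /= <-].
by move=> ou; apply/asboolP/hit_site; exists u.
Qed.

Lemma intensity_ge0 (A : set (mpoint R)) : (0 <= intensity mu A)%E.
Proof. by apply: integral_ge0 => x _; exact: measure_ge0. Qed.

Lemma hit_sites_le (U : set site) :
  (P (hit xi (site_of l a b @^-1` U)) <= intensity mu (site_of l a b @^-1` U))%E.
Proof.
exact: (poisson_hit_le poisson intensity_ge0 (measurable_site_of l0 ab U)).
Qed.

Definition crossing_event z al : set Omega := [set w | crossing (occupied l a b (xi w)) z al].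

Lemma region_exists z al : exists r : seq site, uniq r /\
  forall u, (u \in r) = near_cell u.1 z (3 * al) && (u.2 < al)%N.
Proof.
pose n := (6 * al).+1.
pose f (x : ('I_n * 'I_n) * 'I_al) : site :=
  ((z.1 + x.1.1%:Z - (3 * al)%N%:Z, z.2 + x.1.2%:Z - (3 * al)%N%:Z), x.2 : nat).
pose Q (u : site) := near_cell u.1 z (3 * al) && (u.2 < al)%N.
exists (undup [seq u <- [seq f x | x : ('I_n * 'I_n) * 'I_al] | Q u]).
split; first exact: undup_uniq.
move=> u; rewrite mem_undup mem_filter -/(Q u); case Qu : (Q u) => //=.
case/andP: Qu; case: u => -[u1 u2] k /and4P[/= h1 h2 h3 h4] kal.
have i1 : (absz (u1 - z.1 + (3 * al)%N%:Z)%R < n)%N by rewrite /n; lia.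
have i2 : (absz (u2 - z.2 + (3 * al)%N%:Z)%R < n)%N by rewrite /n; lia.
apply/mapP; exists ((Ordinal i1, Ordinal i2), Ordinal kal); first by rewrite mem_enum.
by rewrite /f /=; congr (_, _, _); lia.
Qed.

Let crossing_fun z al (g : site -> bool) : Prop := crossing (fun u => is_true (g u)) z al.

Let crossing_eventE z al : crossing_event z al = fun_event xi cell (crossing_fun z al).
Proof. by apply/seteqP; split => w; rewrite /crossing_event /fun_event /crossing_fun /= bitE. Qed.

Let crossing_depends z al (r : seq site) :
  (forall u, (u \in r) = near_cell u.1 z (3 * al) && (u.2 < al)%N) ->
  depends_on r (crossing_fun z al).
Proof.
move=> rE g g' gg [t [t' [tz t'z tt']]]; exists t, t'; split => //.
apply: chain_sub tt' => u [gu uz ual]; split => //.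
by rewrite -gg// rE uz ual.
Qed.

Lemma measurable_crossing_event z al : measurable (crossing_event z al).
Proof.
have [r [_ rE]] := region_exists z al.
by rewrite crossing_eventE; apply: measurable_fun_event (crossing_depends rE).
Qed.

Lemma crossing_event_independent z z' al :
  (forall c, near_cell c z (3 * al) -> ~~ near_cell c z' (3 * al)) ->
  P (crossing_event z al `&` crossing_event z' al) =
  (P (crossing_event z al) * P (crossing_event z' al))%E.
Proof.
move=> zz'; have [r [ur rE]] := region_exists z al; have [r' [ur' rE']] := region_exists z' al.
rewrite !crossing_eventE; apply: (independent_fun_events poisson mcell disj (r1 := r) (r2 := r')).
- rewrite cat_uniq ur ur' andbT; apply/hasPn => u; rewrite rE' => /andP[uz' _].
  by rewrite rE; apply/negP => /andP[/zz']; rewrite uz'.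
- exact: crossing_depends.
- exact: crossing_depends.
Qed.

(** A crossing at scale 4 needs an occupied site within [3 * 4 = 12] cells of [z], a box of side
    [25 l]. *)
Lemma crossing_base z : (P (crossing_event z 4) <= ((25 * l) ^+ 2)%:E)%E.
Proof.
apply: (@le_trans _ _ (P (hit xi (site_of l a b @^-1` [set u | near_cell u.1 z 12])))).
  apply: le_measure; rewrite ?inE.
  - exact: measurable_crossing_event.
  - by apply: measurable_hit; exact: measurable_site_of.
  - move=> w [t [t' [_ _ /chain_target[ot' tz _]]]]; apply/hit_site.
    by exists t'.
apply: le_trans (hit_sites_le _) _.
by apply: le_trans (intensity_near_cell l0 ab mu z 12) _.
Qed.

Lemma union_bound (T : Type) (s : seq T) (A : T -> set Omega) (c : R) :
  (forall x, measurable (A x)) -> (forall x, (P (A x) <= c%:E)%E) ->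
  measurable (\big[setU/set0]_(x <- s) A x) /\
  (P (\big[setU/set0]_(x <- s) A x) <= ((size s)%:R * c)%:E)%E.
Proof.
move=> mA Ac; elim: s => [|x s [mU IH]]; first by rewrite big_nil measure0 mul0r.
rewrite big_cons; split; first exact: measurableU.
apply: le_trans (measureU2 P (mA x) mU) _.
by rewrite /= -natr1 mulrDl mul1r addrC EFinD leeD.
Qed.

(** Union bound over the pairs of grid cells from [crossing_scale], with independence for each pair
    of disjoint boxes; [et] pays for an oversized grain. *)
Lemma crossing_step z al (be et : R) : (4 <= al)%N -> 0 <= be ->
  (forall z', (P (crossing_event z' al) <= be%:E)%E) ->
  ((484 ^+ 2)%R%:E * tail_moment a b mu (al%:R * l / 4)%R <= et%:E)%E ->
  (P (crossing_event z (20 * al)) <= ((81 ^ 4)%:R * be ^+ 2 + et)%:E)%E.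
Proof.
move=> al4 be0 Hbe Het.
pose K := ('I_81 * 'I_81)%type.
pose A (x : K * K) := if pselect (forall c, near_cell c (grid_cell z al x.1) (3 * al) ->
      ~~ near_cell c (grid_cell z al x.2) (3 * al))
  then crossing_event (grid_cell z al x.1) al `&` crossing_event (grid_cell z al x.2) al
  else set0.
have mA x : measurable (A x).
  rewrite /A; case: pselect => H //=.
  by apply: measurableI; exact: measurable_crossing_event.
have PA x : (P (A x) <= (be ^+ 2)%:E)%E.
  rewrite /A; case: pselect => H /=; last by rewrite measure0 lee_fin sqr_ge0.
  by rewrite crossing_event_independent// expr2 EFinM lee_pmul.
have [mU PU] := union_bound (enum {: K * K}) mA PA.
have mh : measurable (hit xi (site_of l a b @^-1` large_site z al)).
  by apply: measurable_hit; exact: measurable_site_of.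
apply: (@le_trans _ _ (P (\big[setU/set0]_(x <- enum {: K * K}) A x `|`
    hit xi (site_of l a b @^-1` large_site z al)))).
  apply: le_measure; rewrite ?inE; [exact: measurable_crossing_event|exact: measurableU|].
  move=> w cw; have [hw|hw] := pselect (hit xi (site_of l a b @^-1` large_site z al) w).
    by right.
  left; have al0 : (0 < al)%N by lia.
  have small u : occ w u -> near_cell u.1 z (60 * al) -> (2 * u.2 + 2 <= al)%N.
    move=> Ou uz; apply: contrapT => lu; apply: hw; apply/hit_site; exists u => //.
  have [k [k' [ck ck' kk']]] := crossing_scale al0 cw small.
  rewrite -bigcup_seq; exists (k, k'); first by rewrite /= mem_enum.
  by rewrite /A; case: pselect.
apply: le_trans (measureU2 P mU mh) _.
rewrite EFinD; apply: leeD.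
  have n4 n : (n * n * (n * n) = n ^ 4)%N by rewrite !expnS expn0 muln1 !mulnA.
  by move: PU; rewrite -cardE !card_prod !card_ord n4.
apply: le_trans (hit_sites_le _) _; apply: le_trans Het.
exact: intensity_large_site.
Qed.

End crossing_probability.

(** The number of ordered pairs of cells of the 81 by 81 grid. *)
Definition pair_count {R : realType} : R := (81 ^ 4)%:R.

(* Chosen so that half = 1 / (2 C), with C = 81 ^ 4, reproduces itself in the
   recursion be |-> C be ^ 2 + K m, K = 484 ^ 2, when m is at most this bound. *)
Definition window_bound {R : realType} : R := (4 * pair_count * 484 ^+ 2)^-1.

(** * Absence of percolation in a short window *)

Section no_percolation.
Context {R : realType}.
Variables (a b : R).
Hypothesis (ab : 0 <= a < b).
Variable mu : probability (path_space R) R.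
Hypothesis moment : (\int[mu]_h (oscillation a b h ^+ 2)%:E <= (@window_bound R)%:E)%E.
Context {dO : measure_display} {Omega : measurableType dO} (P : probability Omega R).
Context (xi : {mfun Omega >-> conf R}).
Hypothesis poisson : poisson_point_process P xi (intensity mu).

(* The constants are kept abstract, lest they be computed in unary. *)
Variables (C K K' l half : R).
Hypotheses (Cval : C = pair_count) (KE : K = 484 ^+ 2) (K'E : K' = 31 ^+ 2).
Hypotheses (lE : l = (50 * C)^-1) (halfE : half = (2 * C)^-1).

Let C1 : 1 <= C. Proof. by rewrite Cval ler1n expn_gt0. Qed.
Let C0 : 0 < C. Proof. exact: lt_le_trans C1. Qed.
Let K0 : 0 < K. Proof. by rewrite KE; apply: exprn_gt0; rewrite ltr0n. Qed.
Let K'0 : 0 < K'. Proof. by rewrite K'E; apply: exprn_gt0; rewrite ltr0n. Qed.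
Let l0 : 0 < l. Proof. by rewrite lE invr_gt0 pmulr_rgt0// ltr0n. Qed.
Let half0 : 0 < half. Proof. by rewrite halfE invr_gt0 pmulr_rgt0. Qed.
Let Chalf : C * half = 2^-1.
Proof. by rewrite halfE invfM mulrCA mulfV ?mulr1// gt_eqF. Qed.

Let half1 : half <= 1.
Proof.
apply: (@le_trans _ _ (C * half)); first by rewrite ler_peMl// ltW.
by rewrite Chalf invf_le1// ler1n.
Qed.

Let moment_bound : (K%:E * (@window_bound R)%:E)%E = (half / 2)%:E.
Proof.
rewrite /window_bound -Cval -KE -EFinM invfM mulrCA mulfV ?gt_eqF// mulr1 halfE.
by rewrite -invfM mulrAC -natrM.
Qed.

Let step z n be et : 0 <= be -> (forall z', (P (crossing_event l a b xi z' n) <= be%:E)%E) ->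
  (4 <= n)%N -> (K%:E * tail_moment a b mu (n%:R * l / 4)%R <= et%:E)%E ->
  (P (crossing_event l a b xi z (20 * n)) <= (C * be ^+ 2 + et)%:E)%E.
Proof. by rewrite Cval KE => be0 H n4 He; exact: (crossing_step l0 ab poisson z n4 be0 H He). Qed.

Definition scale (n : nat) : nat := (4 * 20 ^ n)%N.

Lemma scaleS n : scale n.+1 = (20 * scale n)%N.
Proof. by rewrite /scale expnS mulnCA. Qed.

Lemma scale_ge4 n : (4 <= scale n)%N.
Proof. by rewrite /scale leq_pmulr// expn_gt0. Qed.

Lemma scale_gt n : (n < scale n)%N.
Proof.
apply: leq_trans (_ : 20 ^ n <= _)%N; first exact: ltn_expl.
by rewrite /scale leq_pmull.
Qed.

Local Notation CE := (crossing_event l a b xi).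

Let osc0 h : 0 <= oscillation a b h.
Proof. by case/andP: ab => a0 bb; rewrite oscillation_ge0// a0 ltW. Qed.

Let tail_le c : (tail_moment a b mu c <= (@window_bound R)%:E)%E.
Proof.
apply: le_trans moment; apply: ge0_integral_monotone => h; rewrite lee_fin ?sqr_ge0//.
by case: ifP => _ //; rewrite expr0n sqr_ge0.
Qed.

Let crossing_half n z : (P (CE z (scale n)) <= half%:E)%E.
Proof.
elim: n z => [|n IH] z.
  rewrite /scale expn0 muln1; apply: le_trans (crossing_base l0 ab poisson z) _.
  (* The mesh [1 / (50 C)] is chosen for this equality; the induction then starts from
     [half ^ 2 <= half]. *)
  have l25 : 25 * l = half.
    rewrite lE halfE !invfM mulrA; congr (_ * _).
    by rewrite -[50]/(25 * 2)%:R natrM invfM mulrA mulfV ?mul1r// pnatr_eq0.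
  by rewrite lee_fin l25 expr2 ler_piMr ?(ltW half0).
rewrite scaleS; apply: le_trans (step z (ltW half0) IH (scale_ge4 n) (et := half / 2) _) _.
  rewrite -moment_bound; apply: lee_wpmul2l; first by rewrite lee_fin ltW.
  exact: tail_le.
by rewrite lee_fin expr2 mulrA Chalf; lra.
Qed.

Let scale_large (c : R) : exists N, forall n, (N <= n)%N -> c <= (scale n)%:R * l / 16.
Proof.
exists (Num.truncn (c * 16 / l)).+1 => n Nn.
rewrite ler_pdivlMr ?ltr0n// -ler_pdivrMr//.
apply: le_trans (ltW (truncnS_gt _)) _; rewrite ler_nat.
by apply: leq_trans Nn _; exact/ltnW/scale_gt.
Qed.

Let tail_small (e : R) : 0 < e -> exists N, forall n, (N <= n)%N ->
  (tail_moment a b mu ((scale n)%:R * l / 4)%R <= e%:E)%E /\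
  (tail_moment a b mu ((scale n)%:R * l / 16)%R <= e%:E)%E.
Proof.
move=> e0; have [|N0 HN] := @tail_second_moment _ mu (oscillation a b) e (measurable_oscillation ab) osc0 _ e0.
  by apply: le_lt_trans moment _; rewrite ltry.
have [N NP] := scale_large N0%:R; exists N => n /NP cn; split; apply: HN => //.
apply: le_trans cn _; rewrite ler_pM2l ?mulr_gt0 ?ltr0n//; last first.
  by apply: leq_trans (scale_ge4 n).
by rewrite lef_pV2 ?posrE//; lra.
Qed.

(** As [C * half = 1 / 2], below [half] the recursion is at most [be / 2 + e / 4], whose iterates
    approach [e / 2]; the error [e / 4] is reached at large scales because the tail moment
    vanishes. *)
Let crossing_decay (e : R) : 0 < e -> exists N, forall n, (N <= n)%N ->
  (P (CE (0%R, 0%R) (scale n)) <= e%:E)%E.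
Proof.
move=> e0; have [|N0 HN] := @tail_small (e / 4 / K); first by rewrite !divr_gt0.
(* [inv_succ 1] is one half. *)
have dec j z : (P (CE z (scale (N0 + j))) <= (inv_succ 1 ^+ j * half + e / 2)%:E)%E.
  elim: j z => [|j IH] z.
    by apply: le_trans (crossing_half _ z) _; rewrite lee_fin expr0 mul1r lerDl; lra.
  (* The bound by [half] makes the quadratic term contract, the other one is the inductive bound
     that it contracts. *)
  pose be := Num.min (inv_succ 1 ^+ j * half + e / 2) half.
  have be0 : 0 <= be.
    have i0 : 0 <= inv_succ 1 ^+ j :> R by apply/exprn_ge0/ltW/inv_succ_gt0.
    by rewrite /be le_min (ltW half0) andbT addr_ge0 ?mulr_ge0 ?(ltW half0) ?divr_ge0 ?(ltW e0).
  have beP z' : (P (CE z' (scale (N0 + j))) <= be%:E)%E.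
    by rewrite /be; case: (leP (inv_succ 1 ^+ j * half + e / 2) half).
  rewrite addnS scaleS; apply: le_trans (step z be0 beP (scale_ge4 _) (et := e / 4) _) _.
    have [H _] := HN _ (leq_addr j N0).
    apply: le_trans (lee_wpmul2l _ H) _; first by rewrite lee_fin ltW.
    by rewrite -EFinM lee_fin mulrC divfK// gt_eqF.
  have be1 : be <= inv_succ 1 ^+ j * half + e / 2 by rewrite /be ge_min lexx.
  have be2 : be <= half by rewrite /be ge_min lexx orbT.
  have Cbe : C * be ^+ 2 <= be / 2.
    rewrite expr2 mulrA -[leRHS]mulrC ler_wpM2r//.
    by rewrite -Chalf ler_pM2l.
  have E : inv_succ 1 ^+ j.+1 * half = (inv_succ 1 ^+ j * half) / 2 :> R.
    by rewrite exprS [X in X * _ * _]/inv_succ -mulrA mulrC.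
  by rewrite lee_fin E; lra.
have [J HJ] := @inv_small R (e / 2) ltac:(lra).
exists (N0 + J)%N => n nN; rewrite -(subnKC (leq_trans (leq_addr J N0) nN)).
apply: le_trans (dec _ _) _; rewrite lee_fin.
have jJ : (J <= n - N0)%N by rewrite leq_subRL ?(leq_trans (leq_addr J N0) nN).
move: (n - N0)%N jJ => j jJ.
have := HJ j jJ.
have h1 : inv_succ 1 ^+ j <= inv_succ j :> R.
  rewrite /inv_succ exprVn lef_pV2 ?posrE ?exprn_gt0// -natrX ler_nat.
  exact: ltn_expl.
have h3 : inv_succ 1 ^+ j * half <= inv_succ j.
  apply: le_trans h1; rewrite ler_piMr// exprn_ge0//; exact/ltW/inv_succ_gt0.
lra.
Qed.

Let far_decay (e : R) : 0 < e -> exists N, forall n, (N <= n)%N ->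
  (P (hit xi (site_of l a b @^-1` far_large_site (scale n))) <= e%:E)%E.
Proof.
move=> e0; have [|N HN] := @tail_small (e / K'); first by rewrite divr_gt0.
exists (maxn N 16) => n; rewrite geq_max => /andP[Nn n16].
apply: le_trans (hit_sites_le l0 ab poisson _) _.
apply: le_trans (intensity_far_large_site l0 ab mu _) _.
  by apply: leq_trans n16 _; exact/ltnW/scale_gt.
have [_ H] := HN _ Nn.
rewrite -K'E; apply: le_trans (lee_wpmul2l _ H) _; first by rewrite lee_fin ltW.
by rewrite -EFinM lee_fin mulrC divfK// gt_eqF.
Qed.

Definition confined_window (S : conf R) := forall p, mconf_set S p ->
  exists C, [/\ finite_set C, C `<=` mconf_set S, C p & window_closed S a b C].

(** The bad event [B n] has probability tending to 0, so that being bad at all scales from some rank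
    on is negligible; otherwise good scales exceed every bound. *)
Lemma negligible_not_confined :
  P.-negligible [set w | locally_finite (xi w) /\ ~ confined_window (xi w)].
Proof.
pose B n := CE (0%R, 0%R) (scale n) `|` hit xi (site_of l a b @^-1` far_large_site (scale n)).
have mB n : measurable (B n).
  apply: measurableU; first exact: measurable_crossing_event.
  by apply: measurable_hit; exact: measurable_site_of.
have B0 N : P (\bigcap_(n >= N) B n) = 0%E.
  apply/eqP; rewrite eq_le measure_ge0 andbT; apply/lee_addgt0Pr => e e0.
  rewrite add0e; have e2 : 0 < e / 2 by lra.
  have [N1 H1] := crossing_decay e2; have [N2 H2] := far_decay e2.
  pose n := maxn N (maxn N1 N2).
  apply: (@le_trans _ _ (P (B n))).
    apply: le_measure; rewrite ?inE; [|exact: mB|].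
      by apply: bigcap_measurable => [|k _]; [exists N => /=|exact: mB].
    by apply: bigcap_inf; rewrite /= leq_maxl.
  apply: le_trans (measureU2 P _ _) _.
  - exact: measurable_crossing_event.
  - by apply: measurable_hit; exact: measurable_site_of.
  rewrite [e in (_ <= e%:E)%E]splitr EFinD; apply: leeD.
    by apply: H1; rewrite !leq_max leqnn orbT.
  by apply: H2; rewrite !leq_max leqnn !orbT.
apply: (@negligibleS _ _ _ _ (\bigcup_N \bigcap_(n >= N) B n)); last first.
  apply: negligible_bigcup => N; exists (\bigcap_(n >= N) B n); split=> //; last exact: B0.
  by apply: bigcap_measurable => [|k _]; [exists N => /=|exact: mB].
move=> w /= [fS nc]; apply: contrapT => nB; apply: nc.
have a0 : 0 <= a <= b by case/andP: ab => -> /ltW ->.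
apply: (confined_window_closed l0 a0 fS) => N.
have [n [Nn nBn]] : exists n, (N <= n)%N /\ ~ B n w.
  apply: contrapT => H; apply: nB; exists N => // n /= Nn.
  by apply: contrapT => nBn; apply: H; exists n.
exists (scale n); first by apply: leq_trans Nn _; exact/ltnW/scale_gt.
split; first by move=> cr; apply: nBn; left.
move=> u m [p Sp up] nm um; apply: contrapT => lu; apply: nBn; right.
by apply/hitP; exists p => //; rewrite /= up; exists m.
Qed.

End no_percolation.

(** * From the windows to the whole time axis *)

Section window_partition.
Context {R : realType}.
Implicit Types (S : conf R) (T : R).

Lemma stable_windows S T N : 0 < T -> (0 < N)%N -> locally_finite S ->
  (forall k, (k < N)%N -> confined_window (k%:R * (T / N%:R)) (k.+1%:R * (T / N%:R)) S) ->
  forall p, mconf_set S p -> stable S T p.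
Proof.
move=> T0 N0 fS H.
have G k : (k <= N)%N -> forall p, mconf_set S p -> stable S (k%:R * (T / N%:R)) p.
  elim: k => [_ p _|k IH kN p Sp]; first by rewrite mul0r; exact: stable0.
  have [C [finC CS Cp Ccl]] := H k kN p Sp.
  exact: (stable_step fS (IH (ltnW kN)) finC Ccl Cp).
by move=> p /(G N (leqnn N)); rewrite mulrCA mulfV ?mulr1// pnatr_eq0 -lt0n.
Qed.

End window_partition.

Section poisson_determined.
Context {R : realType} (mu : probability (path_space R) R).
Hypothesis moment : forall T, 0 < T -> (\int[mu]_h (oscillation 0 T h ^+ 2)%:E < +oo)%E.
Context {dO : measure_display} {Omega : measurableType dO} (P : probability Omega R).
Context (xi : {mfun Omega >-> conf R}).
Hypothesis poisson : poisson_point_process P xi (intensity mu).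

Lemma intensity_visits n m : (intensity mu (visits n m) < +oo)%E.
Proof.
(* A path visiting the ball starts within [c + o h] of the origin. The horizon [m.+1] keeps the
   interval nondegenerate when [m] is 0. *)
pose c : R := n%:R; pose o (h : path_space R) := oscillation 0 m.+1%:R h.
have mo : measurable_fun setT o by apply: measurable_oscillation; rewrite lexx ltr0n.
have o0 h : 0 <= o h by rewrite oscillation_ge0// lexx ler0n.
have c0 : 0 <= c by rewrite ler0n.
apply: (@le_lt_trans _ _ (\int[mu]_h ((2 * (c + o h)) ^+ 2)%:E)%E).
  apply: intensity_le => [|||h].
  - exact: measurable_visits.
  - by apply: measurable_funM => //; exact: measurable_funD.
  - by move=> h; rewrite mulr_ge0// addr_ge0.
  - exists (- (c + o h), - (c + o h)) => y [r [/andP[r0 rm] yr]].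
    have : `|y| <= c + o h.
      have hr : `|h (ratr r)| <= o h.
        rewrite -[h _]subr0 -(path_at0 h); apply: le_oscillation => //.
        by rewrite r0 (le_trans rm)// ler_nat.
      have -> : y = gpos (y, h) (ratr r) - h (ratr r) by rewrite /gpos addrK.
      by apply: le_trans (ler_normB _ _) _; rewrite lerD// ltW.
    rewrite prod_norm_le => /andP[/=].
    by rewrite !ler_norml => /andP[? ?] /andP[? ?]; lra.
apply: (@le_lt_trans _ _ (\int[mu]_h ((8 * c ^+ 2)%:E + 8%:E * (o h ^+ 2)%:E))%E).
  apply: ge0_integral_monotone => h; first by rewrite lee_fin sqr_ge0.
  rewrite -EFinM -EFinD lee_fin; have := sqr_ge0 (c - o h); lra.
rewrite ge0_integralD//=; last 3 first.
- by move=> h _; rewrite lee_fin mulr_ge0// sqr_ge0.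
- by move=> h _; rewrite -EFinM lee_fin mulr_ge0// sqr_ge0.
- by apply: measurable_funeM; apply/measurable_EFinP; exact: measurable_funX.
rewrite lte_add_pinfty//.
  by rewrite integral_cst//= probability_setT mule1 ltry.
rewrite ge0_integralZl//.
- by rewrite lte_mul_pinfty//; apply: moment; rewrite ltr0n.
- by apply/measurable_EFinP; exact: measurable_funX.
- by move=> h _; rewrite lee_fin sqr_ge0.
Qed.

Lemma negligible_not_locally_finite : P.-negligible [set w | ~ locally_finite (xi w)].
Proof.
apply: (@negligibleS _ _ _ _ (\bigcup_n \bigcup_m [set w | mcount (visits n m) (xi w) = +oo%E])).
  move=> w /= nf; apply: contrapT => H; apply: nf => n m.
  apply: contrapT => inf; apply: H; exists n => //; exists m => //=.
  by rewrite /mcount /counting; case: asboolP.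
apply: negligible_bigcup => n; apply: negligible_bigcup => m.
apply: (poisson_count_finite poisson); first exact: measurable_visits.
exact: intensity_visits.
Qed.

Lemma negligible_not_stable T : 0 < T -> P.-negligible
  [set w | locally_finite (xi w) /\ ~ (forall p, mconf_set (xi w) p -> stable (xi w) T p)].
Proof.
move=> T0.
have w0 : 0 < @window_bound R.
  by rewrite /window_bound invr_gt0 !mulr_gt0 ?exprn_gt0 ?ltr0n ?expn_gt0.
have [N N0 HN] := small_windows moment T0 w0.
apply: (@negligibleS _ _ _ _ (\bigcup_k [set w | (k < N)%N /\ (locally_finite (xi w) /\
    ~ confined_window (k%:R * (T / N%:R)) (k.+1%:R * (T / N%:R)) (xi w))])).
  move=> w /= [fS ns]; apply: contrapT => H; apply: ns.
  apply: (stable_windows T0 N0 fS) => k kN; apply: contrapT => nc.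
  by apply: H; exists k.
apply: negligible_bigcup => k.
have [kN|Nk] := ltnP k N; last first.
  apply: (@negligibleS _ _ _ _ set0); last exact: negligible_set0.
  by move=> w [].
have ab : 0 <= k%:R * (T / N%:R) < k.+1%:R * (T / N%:R).
  have TN : 0 < T / N%:R by rewrite divr_gt0// ltr0n.
  by rewrite mulr_ge0 ?ler0n ?(ltW TN)//= ltr_pM2r// ltr_nat.
(* The five equations give the abstract constants their values. *)
apply: (negligibleS _ (negligible_not_confined ab (HN k kN) poisson
  erefl erefl erefl erefl erefl)).
by move=> w [].
Qed.

Lemma poisson_determined : P (xi @^-1` determined) = 1%E.
Proof.
have mD : measurable (xi @^-1` determined).
  rewrite -[X in measurable X]setTI.
  by apply: (measurable_funPT xi) => //; exact: measurable_determined.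
pose bad n := [set w | locally_finite (xi w) /\
  ~ (forall p, mconf_set (xi w) p -> stable (xi w) n.+1%:R p)].
have : P.-negligible (~` (xi @^-1` determined)).
  apply: (@negligibleS _ _ _ _ ([set w | ~ locally_finite (xi w)] `|` \bigcup_n bad n)).
    move=> w nD; have [fS|] := pselect (locally_finite (xi w)); last by left.
    right; apply: contrapT => nb; apply: nD; split=> // p Sp.
    apply: stable_lower_eq_upper => -[|n]; first exact: stable0.
    by move: p Sp; apply: contrapT => ns; apply: nb; exists n.
  apply: negligibleU; first exact: negligible_not_locally_finite.
  by apply: negligible_bigcup => n; apply: negligible_not_stable; rewrite ltr0n.
move=> /(measure_negligible (measurableC mD)) D0.
by rewrite -[X in P X]setCK probability_setC ?D0 ?sube0//; exact: measurableC.
Qed.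

End poisson_determined.

Theorem proposition4 (R : realType) (mu : probability (path_space R) R)
    (d : measure_display) (Omega : measurableType d) (P : probability Omega R)
    (h : {mfun Omega >-> path_space R})
    (h_law : forall A : set (path_space R), measurable A ->
       distribution P h A = mu A)
    (h_moment : forall t : R, 0 <= t ->
       ('E_P[fun w => (sup [set sqnorm (h w s) | s in `[0, t]])%R] < +oo)%E) :
  tempered mu.
Proof.
exists determined; split; first exact: determined_tempered_set.
move=> dO Omega' P' xi poisson; apply: poisson_determined poisson => T T0.
by apply: (path_second_moment h_law) => //; exact/h_moment/ltW.
Qed.
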